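(* Let $\mathbf{k}$ be a commutative ring with 1 and let $\Gamma$ be a row-finite digraph. If $\Lambda$ is a reduction of $\Gamma$, then $L_{\mathbf{k}}(\Gamma)$ and $L_{\mathbf{k}}(\Lambda)$ are Morita equivalent, that is, their categories of unital modules are equivalent. Moreover, $L_{\mathbf{k}}(\Lambda)$ is isomorphic to a subalgebra of $L_{\mathbf{k}}(\Gamma)$, and a Morita equivalence is given by the restriction functor from $Mod_{L_{\mathbf{k}}(\Gamma)}$ to $Mod_{L_{\mathbf{k}}(\Lambda)}$.
   Context: A digraph $\Gamma=(V,E,s,t)$ has vertex set $V$, arrow set $E$, and source and target maps $s,t:E\to V$ (written $se$, $te$). It is row-finite if $s^{-1}(v)$ is finite for all $v\in V$. A sink is a vertex $v$ with $s^{-1}(v)=\emptyset$; a loop is an arrow $e$ with $se=te$; a vertex is loopless if no loop starts at it. Paths are sequences $e_1\cdots e_n$ of arrows with $te_i=se_{i+1}$, or vertices (length 0). Reduction: given a loopless nonsink $v\in V$, replace each path $fg$ of length 2 with $tf=v=sg$ by a new arrow, labeled $fg$, from $sf$ to $tg$, and delete $v$ and all arrows touching $v$. (If $v$ is a source, simply delete $v$ and all arrows starting at $v$.) This may be repeated finitely many times as long as there is a loopless nonsink; any digraph obtained in this process is called a reduction of $\Gamma$. The Leavitt path algebra $L_{\mathbf{k}}(\Gamma)$ is the (not necessarily unital) $\mathbf{k}$-algebra generated by $V\sqcup E\sqcup E^*$, where $E^*=\{e^*: e\in E\}$ with $s(e^* )=te$, $t(e^* )=se$, subject to: (V) $vw=\delta_{v,w}v$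 for $v,w\in V$; (E) $(se)e=e=e(te)$ for $e\in E\sqcup E^*$; (CK1) $e^*f=\delta_{e,f}\,te$ for $e,f\in E$; (CK2) $v=\sum_{se=v}ee^*$ for all $v\in V$ with $0<|s^{-1}(v)|<\infty$. A right $R$-module $M$ is unital if $M=MR$; $Mod_R$ denotes the category of unital right $R$-modules. A reduction $\Lambda$ is related to $\Gamma$ by the $*$-algebra homomorphism $L_{\mathbf{k}}(\Lambda)\to L_{\mathbf{k}}(\Gamma)$ sending each vertex and original arrow to itself and each new arrow labeled by a path of $\Gamma$ to that path. The restriction functor sends a unital $L_{\mathbf{k}}(\Gamma)$-module $M=\bigoplus_{v\in V}Mv$ to $\bigoplus_{u\in V_\Lambda}Mu$ ($V_\Lambda$ the vertex set of $\Lambda$), with $L_{\mathbf{k}}(\Lambda)$ acting through this homomorphism (equivalently, it restricts the corresponding quiver representation $v\mapsto Mv$ to the vertices of $\Lambda$, assigning to each new arrow the composition of the maps along its path). *)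

(* Defs.v *)
From HB Require Import structures.
From mathcomp Require Import all_boot all_order all_algebra generic_quotient.
From mathcomp Require Import finmap all_classical.

Set Implicit Arguments.
Unset Strict Implicit.
Unset Printing Implicit Defensive.

Import GRing.Theory.

Local Open Scope classical_set_scope.
Local Open Scope ring_scope.
Local Open Scope quotient_scope.

Record digraph := Digraph {
  vert : choiceType;
  arrow : choiceType;
  src : arrow -> vert;
  tgt : arrow -> vert
}.
Arguments src {d}.
Arguments tgt {d}.

Definition out (G : digraph) (v : vert G) : set (arrow G) :=
  [set e | src e = v].

Definition row_finite (G : digraph) : Prop :=
  forall v : vert G, finite_set (out v).

Definition sink (G : digraph) (v : vert G) : Prop := out v = set0.

Definition is_loop (G : digraph) (e : arrow G) : Prop := src e = tgt e.

Definition loopless (G : digraph) (v : vert G) : Prop :=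
  forall e, out v e -> ~ is_loop e.

Section ReduceAt.
Variables (G : digraph) (v : vert G).
Hypothesis hv : loopless v.

Definition red_vert := {u : vert G | u != v}.

Definition kept_arrow := {e : arrow G | (src e != v) && (tgt e != v)}.
Definition path2_through :=
  {fg : arrow G * arrow G | (tgt fg.1 == v) && (src fg.2 == v)}.

Lemma kept_srcP (e : kept_arrow) : src (val e) != v.
Proof. by have /andP[] := valP e. Qed.

Lemma kept_tgtP (e : kept_arrow) : tgt (val e) != v.
Proof. by have /andP[] := valP e. Qed.

Lemma path2_srcP (fg : path2_through) : src (val fg).1 != v.
Proof.
have /andP[/eqP tf _] := valP fg; apply/negP => /eqP sf.
by apply: (hv sf); rewrite /is_loop sf tf.
Qed.

Lemma path2_tgtP (fg : path2_through) : tgt (val fg).2 != v.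
Proof.
have /andP[_ /eqP sg] := valP fg; apply/negP => /eqP tg.
by apply: (hv sg); rewrite /is_loop sg tg.
Qed.

Definition red_src (x : kept_arrow + path2_through) : red_vert :=
  match x with
  | inl e => Sub (src (val e)) (kept_srcP e)
  | inr fg => Sub (src (val fg).1) (path2_srcP fg)
  end.

Definition red_tgt (x : kept_arrow + path2_through) : red_vert :=
  match x with
  | inl e => Sub (tgt (val e)) (kept_tgtP e)
  | inr fg => Sub (tgt (val fg).2) (path2_tgtP fg)
  end.

Definition reduce_at : digraph :=
  @Digraph red_vert (kept_arrow + path2_through)%type red_src red_tgt.

End ReduceAt.

(** [L] is obtained from [G] by finitely many (possibly no) reduction steps;
    [iota] regards the vertices of [L] as vertices of [G], and [lab]
    is the labeling of the arrows of [L] by paths of [G]. *)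
Inductive reduction (G : digraph) :
  forall L : digraph, (vert L -> vert G) -> (arrow L -> seq (arrow G)) -> Prop :=
| reduction_refl : @reduction G G id (fun e => [:: e])
| reduction_step (L : digraph) (iota : vert L -> vert G)
    (lab : arrow L -> seq (arrow G)) (v : vert L) (hv : loopless v) :
    reduction iota lab -> ~ sink v ->
    @reduction G (reduce_at hv)
      (fun u => iota (val u))
      (fun x => match x with
                | inl e => lab (val e)
                | inr fg => lab (val fg).1 ++ lab (val fg).2
                end).

HB.mixin Record isNUAlgebra (k : comPzRingType) A of GRing.Lmodule k A := {
  numul : A -> A -> A;
  numulA : associative numul;
  numulDl : left_distributive numul +%R;
  numulDr : right_distributive numul +%R;
  nuscaleAl : forall (c : k) (x y : A), c *: numul x y = numul (c *: x) y;
  nuscaleAr : forall (c : k) (x y : A), c *: numul x y = numul x (c *: y)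
}.

#[short(type="nuAlgType")]
HB.structure Definition NUAlgebra (k : comPzRingType) :=
  {A of isNUAlgebra k A & GRing.Lmodule k A}.

Notation "x ** y" := (numul x y) (at level 40, left associativity) : ring_scope.

Record nuhom (k : comPzRingType) (A B : nuAlgType k) := NUHom {
  nuhom_fun :> {linear A -> B};
  nuhomM : {morph nuhom_fun : x y / x ** y}
}.

Definition subalgebra (k : comPzRingType) (B : nuAlgType k) (S : set B) : Prop :=
  [/\ S 0,
      forall x y, S x -> S y -> S (x + y),
      forall (c : k) x, S x -> S (c *: x)
    & forall x y, S x -> S y -> S (x ** y)].

Definition isomorphic_to_subalgebra (k : comPzRingType) (A B : nuAlgType k) :
    Prop :=
  exists2 S : set B, subalgebra S &
  exists f : nuhom A B, set_bij setT S f.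

(** The algebra presented by generators [X] and relations [R] is the set of
    formal non-unital algebra expressions in [X], modulo the least congruence
    that contains [R] and the axioms of associative [k]-algebras. *)

Inductive expr (k X : Type) : Type :=
| Gen of X
| Zero
| Add of expr k X & expr k X
| Opp of expr k X
| Scale of k & expr k X
| Mul of expr k X & expr k X.
Arguments Gen {k X}.
Arguments Zero {k X}.

HB.instance Definition _ (k X : Type) := gen_eqMixin (expr k X).
HB.instance Definition _ (k X : Type) := gen_choiceMixin (expr k X).

Section Presentation.
Variables (k : comPzRingType) (X : Type).
Variable R : expr k X -> expr k X -> Prop.
Local Notation expr := (expr k X).

Inductive congr_of : expr -> expr -> Prop :=
| cg_rel x y : R x y -> congr_of x y
| cg_refl x : congr_of x x
| cg_sym x y : congr_of x y -> congr_of y x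
| cg_trans y x z : congr_of x y -> congr_of y z -> congr_of x z
| cg_Add x x' y y' :
    congr_of x x' -> congr_of y y' -> congr_of (Add x y) (Add x' y')
| cg_Opp x x' : congr_of x x' -> congr_of (Opp x) (Opp x')
| cg_Scale c x x' : congr_of x x' -> congr_of (Scale c x) (Scale c x')
| cg_Mul x x' y y' :
    congr_of x x' -> congr_of y y' -> congr_of (Mul x y) (Mul x' y')
| cg_addA x y z : congr_of (Add x (Add y z)) (Add (Add x y) z)
| cg_addC x y : congr_of (Add x y) (Add y x)
| cg_add0 x : congr_of (Add Zero x) x
| cg_addN x : congr_of (Add (Opp x) x) Zero
| cg_scaleA a b x : congr_of (Scale a (Scale b x)) (Scale (a * b) x)
| cg_scale1 x : congr_of (Scale 1 x) x
| cg_scaleDr a x y :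
    congr_of (Scale a (Add x y)) (Add (Scale a x) (Scale a y))
| cg_scaleDl a b x :
    congr_of (Scale (a + b) x) (Add (Scale a x) (Scale b x))
| cg_mulA x y z : congr_of (Mul x (Mul y z)) (Mul (Mul x y) z)
| cg_mulDl x y z : congr_of (Mul (Add x y) z) (Add (Mul x z) (Mul y z))
| cg_mulDr x y z : congr_of (Mul x (Add y z)) (Add (Mul x y) (Mul x z))
| cg_scaleAl c x y : congr_of (Scale c (Mul x y)) (Mul (Scale c x) y)
| cg_scaleAr c x y : congr_of (Scale c (Mul x y)) (Mul x (Scale c y)).

Definition congrb : rel expr := fun x y => `[< congr_of x y >].

Lemma congrb_refl : reflexive congrb.
Proof. by move=> x; apply/asboolP; exact: cg_refl. Qed.

Lemma congrb_sym : symmetric congrb.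
Proof.
by move=> x y; apply/asboolP/asboolP; exact: cg_sym.
Qed.

Lemma congrb_trans : transitive congrb.
Proof.
by move=> y x z /asboolP xy /asboolP yz; apply/asboolP; exact: cg_trans xy yz.
Qed.

Canonical congr_equiv := EquivRel congrb congrb_refl congrb_sym congrb_trans.

Definition presented := {eq_quot congr_equiv}.
HB.instance Definition _ := Choice.on presented.

Definition pres (x : expr) : presented := \pi_({eq_quot congr_equiv}) x.

Lemma pres_eqP x y : pres x = pres y <-> congr_of x y.
Proof.
split=> [/eqP|xy]; first by rewrite eqmodE => /asboolP.
by apply/eqP; rewrite eqmodE; apply/asboolP.
Qed.

Definition pres_repr (a : presented) : expr := @repr _ {eq_quot congr_equiv} a.

Lemma pres_reprK : cancel pres_repr pres.
Proof. by move=> a; exact: reprK. Qed.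

Lemma pres_repr_congr x : congr_of (pres_repr (pres x)) x.
Proof. by apply/pres_eqP; rewrite pres_reprK. Qed.

Lemma presW (P : presented -> Prop) : (forall x, P (pres x)) -> forall a, P a.
Proof. by move=> Px a; rewrite -[a]pres_reprK. Qed.

Definition pres_zero : presented := pres Zero.
Definition pres_add (a b : presented) : presented :=
  pres (Add (pres_repr a) (pres_repr b)).
Definition pres_opp (a : presented) : presented := pres (Opp (pres_repr a)).
Definition pres_scale (c : k) (a : presented) : presented :=
  pres (Scale c (pres_repr a)).
Definition pres_mul (a b : presented) : presented :=
  pres (Mul (pres_repr a) (pres_repr b)).

Lemma pres_addE x y : pres_add (pres x) (pres y) = pres (Add x y).
Proof. by apply/pres_eqP; apply: cg_Add; exact: pres_repr_congr. Qed.

Lemma pres_oppE x : pres_opp (pres x) = pres (Opp x).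
Proof. by apply/pres_eqP; apply: cg_Opp; exact: pres_repr_congr. Qed.

Lemma pres_scaleE c x : pres_scale c (pres x) = pres (Scale c x).
Proof. by apply/pres_eqP; apply: cg_Scale; exact: pres_repr_congr. Qed.

Lemma pres_mulE x y : pres_mul (pres x) (pres y) = pres (Mul x y).
Proof. by apply/pres_eqP; apply: cg_Mul; exact: pres_repr_congr. Qed.

Let presE := (pres_addE, pres_oppE, pres_scaleE, pres_mulE).

Lemma pres_addA : associative pres_add.
Proof.
do 3!elim/presW => ?; rewrite !presE; apply/pres_eqP; exact: cg_addA.
Qed.

Lemma pres_addC : commutative pres_add.
Proof. do 2!elim/presW => ?; rewrite !presE; apply/pres_eqP; exact: cg_addC. Qed.

Lemma pres_add0 : left_id pres_zero pres_add.
Proof. elim/presW => ?; rewrite !presE; apply/pres_eqP; exact: cg_add0. Qed.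

Lemma pres_addN : left_inverse pres_zero pres_opp pres_add.
Proof. elim/presW => ?; rewrite !presE; apply/pres_eqP; exact: cg_addN. Qed.

HB.instance Definition _ :=
  GRing.isZmodule.Build presented pres_addA pres_addC pres_add0 pres_addN.

Lemma pres_scaleA a b x :
  pres_scale a (pres_scale b x) = pres_scale (a * b) x.
Proof. elim/presW: x => ?; rewrite !presE; apply/pres_eqP; exact: cg_scaleA. Qed.

Lemma pres_scale1 : left_id 1 pres_scale.
Proof. elim/presW => ?; rewrite !presE; apply/pres_eqP; exact: cg_scale1. Qed.

Lemma pres_scaleDr : right_distributive pres_scale +%R.
Proof.
move=> c; do 2!elim/presW => ?; rewrite /GRing.add/= !presE.
by apply/pres_eqP; exact: cg_scaleDr.
Qed.

Lemma pres_scaleDl x : {morph pres_scale^~ x : a b / a + b}.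
Proof.
elim/presW: x => ? a b; rewrite [RHS]/GRing.add/= !presE.
by apply/pres_eqP; exact: cg_scaleDl.
Qed.

HB.instance Definition _ :=
  GRing.Zmodule_isLmodule.Build k presented
    pres_scaleA pres_scale1 pres_scaleDr pres_scaleDl.

Lemma pres_mulA : associative pres_mul.
Proof.
do 3!elim/presW => ?; rewrite !presE; apply/pres_eqP; exact: cg_mulA.
Qed.

Lemma pres_mulDl : left_distributive pres_mul +%R.
Proof.
do 3!elim/presW => ?; rewrite /GRing.add/= !presE; apply/pres_eqP.
exact: cg_mulDl.
Qed.

Lemma pres_mulDr : right_distributive pres_mul +%R.
Proof.
do 3!elim/presW => ?; rewrite /GRing.add/= !presE; apply/pres_eqP.
exact: cg_mulDr.
Qed.

Lemma pres_scaleAl (c : k) (x y : presented) :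
  c *: pres_mul x y = pres_mul (c *: x) y.
Proof.
elim/presW: x => ?; elim/presW: y => ?; rewrite /GRing.scale/= !presE.
by apply/pres_eqP; exact: cg_scaleAl.
Qed.

Lemma pres_scaleAr (c : k) (x y : presented) :
  c *: pres_mul x y = pres_mul x (c *: y).
Proof.
elim/presW: x => ?; elim/presW: y => ?; rewrite /GRing.scale/= !presE.
by apply/pres_eqP; exact: cg_scaleAr.
Qed.

HB.instance Definition _ :=
  isNUAlgebra.Build k presented
    pres_mulA pres_mulDl pres_mulDr pres_scaleAl pres_scaleAr.

Lemma presD x y : pres (Add x y) = pres x + pres y.
Proof. by rewrite -pres_addE. Qed.

Lemma presN x : pres (Opp x) = - pres x.
Proof. by rewrite -pres_oppE. Qed.

Lemma presZ c x : pres (Scale c x) = c *: pres x.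
Proof. by rewrite -pres_scaleE. Qed.

Lemma presM x y : pres (Mul x y) = pres x ** pres y.
Proof. by rewrite -pres_mulE. Qed.

Lemma pres0 : pres Zero = 0.
Proof. by []. Qed.

End Presentation.

Inductive lpa_gen (G : digraph) : Type :=
| GVert of vert G
| GArrow of arrow G
| GGhost of arrow G.

Section Leavitt.
Variables (k : comPzRingType) (G : digraph).

Local Notation V v := (Gen (GVert v) : expr k (lpa_gen G)).
Local Notation E e := (Gen (GArrow e) : expr k (lpa_gen G)).
Local Notation S e := (Gen (GGhost e) : expr k (lpa_gen G)).

Inductive lpa_rel : expr k (lpa_gen G) -> expr k (lpa_gen G) -> Prop :=
| lpa_V (v w : vert G) :
    lpa_rel (Mul (V v) (V w)) (if v == w then V v else Zero)
| lpa_E_src (e : arrow G) : lpa_rel (Mul (V (src e)) (E e)) (E e)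
| lpa_E_tgt (e : arrow G) : lpa_rel (Mul (E e) (V (tgt e))) (E e)
| lpa_S_src (e : arrow G) : lpa_rel (Mul (V (tgt e)) (S e)) (S e)
| lpa_S_tgt (e : arrow G) : lpa_rel (Mul (S e) (V (src e))) (S e)
| lpa_CK1 (e f : arrow G) :
    lpa_rel (Mul (S e) (E f)) (if e == f then V (tgt e) else Zero)
| lpa_CK2 (v : vert G) :
    finite_set (out v) -> ~ sink v ->
    lpa_rel (V v)
      (\big[@Add k (lpa_gen G)/Zero]_(e <- fset_set (out v)) Mul (E e) (S e)).

Definition leavitt : nuAlgType k := presented lpa_rel.

Definition lvert (v : vert G) : leavitt := pres lpa_rel (V v).
Definition larrow (e : arrow G) : leavitt := pres lpa_rel (E e).
Definition lghost (e : arrow G) : leavitt := pres lpa_rel (S e).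

(** The path [p] starting at [u] as an element of the algebra, and its image
    under the involution; the path of length 0 at [u] is the vertex [u]. *)
Definition lpath (u : vert G) (p : seq (arrow G)) : leavitt :=
  foldl (fun x e => x ** larrow e) (lvert u) p.
Definition lpath_star (u : vert G) (p : seq (arrow G)) : leavitt :=
  foldl (fun x e => lghost e ** x) (lvert u) p.

Lemma lvertM v w : lvert v ** lvert w = if v == w then lvert v else 0.
Proof.
rewrite -presM; have /pres_eqP -> := cg_rel (lpa_V v w); by case: ifP.
Qed.

Lemma lvert_id v : lvert v ** lvert v = lvert v.
Proof. by rewrite lvertM eqxx. Qed.

Lemma larrow_tgt e : larrow e ** lvert (tgt e) = larrow e.
Proof. rewrite -presM; apply/pres_eqP; exact/cg_rel/lpa_E_tgt. Qed.

Lemma lghost_tgt e : lghost e ** lvert (src e) = lghost e.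
Proof. rewrite -presM; apply/pres_eqP; exact/cg_rel/lpa_S_tgt. Qed.

Lemma leavitt_sum_vert (a : leavitt) :
  exists s : seq (leavitt * vert G), a = \sum_(p <- s) p.1 ** lvert p.2.
Proof.
have numul0 (x : leavitt) : x ** 0 = 0.
  by apply: (addrI (x ** 0)); rewrite -numulDr !addr0.
elim/presW: a => x.
elim: x => [[v|e|e]||x [s hs] y [t ht]|x [s hs]|c x [s hs]|x _ y [t ht]].
- by exists [:: (lvert v, v)]; rewrite big_seq1 lvert_id.
- by exists [:: (larrow e, tgt e)]; rewrite big_seq1 larrow_tgt.
- by exists [:: (lghost e, src e)]; rewrite big_seq1 lghost_tgt.
- by exists [::]; rewrite big_nil pres0.
- by exists (s ++ t); rewrite big_cat presD hs ht.
- exists [seq (-1 *: p.1, p.2) | p <- s].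
  rewrite big_map presN hs -scaleN1r scaler_sumr.
  by apply: eq_bigr => p _; rewrite nuscaleAl.
- exists [seq (c *: p.1, p.2) | p <- s].
  rewrite big_map presZ hs scaler_sumr.
  by apply: eq_bigr => p _; rewrite nuscaleAl.
- exists [seq (pres lpa_rel x ** p.1, p.2) | p <- t].
  rewrite big_map presM ht.
  rewrite (big_morph _ (numulDr (pres lpa_rel x)) (numul0 _)).
  by apply: eq_bigr => p _; rewrite numulA.
Qed.

End Leavitt.

Record category := Category {
  obj : Type;
  hom : obj -> obj -> Type;
  idm : forall a, hom a a;
  comp : forall a b c, hom b c -> hom a b -> hom a c;
  comp_idl : forall a b (f : hom a b), comp (idm b) f = f;
  comp_idr : forall a b (f : hom a b), comp f (idm a) = f;
  compA : forall a b c d (f : hom c d) (g : hom b c) (h : hom a b),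
    comp f (comp g h) = comp (comp f g) h
}.
Arguments idm {_}.
Arguments comp {_ _ _ _}.

Record functor (C D : category) := Functor {
  fobj :> obj C -> obj D;
  fmap : forall a b, hom a b -> hom (fobj a) (fobj b);
  fmap_id : forall a, fmap (idm a) = idm (fobj a);
  fmap_comp : forall a b c (f : hom b c) (g : hom a b),
    fmap (comp f g) = comp (fmap f) (fmap g)
}.
Arguments fmap {_ _} _ {_ _}.

Definition functor_id (C : category) : functor C C :=
  @Functor C C id (fun _ _ f => f) (fun _ => erefl) (fun _ _ _ _ _ => erefl).

Section FunctorComp.
Variables (C D E : category) (G : functor D E) (F : functor C D).

Lemma fcomp_id a : fmap G (fmap F (idm a)) = idm (G (F a)).
Proof. by rewrite !fmap_id. Qed.

Lemma fcomp_comp a b c (f : hom b c) (g : hom a b) :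
  fmap G (fmap F (comp f g)) = comp (fmap G (fmap F f)) (fmap G (fmap F g)).
Proof. by rewrite !fmap_comp. Qed.

Definition functor_comp : functor C E :=
  @Functor C E (fun a => G (F a)) (fun _ _ f => fmap G (fmap F f))
    fcomp_id fcomp_comp.
End FunctorComp.

Definition is_iso (C : category) (a b : obj C) (f : hom a b) : Prop :=
  exists g : hom b a, comp g f = idm a /\ comp f g = idm b.

Definition nat_isomorphic (C D : category) (F G : functor C D) : Prop :=
  exists eta : forall a, hom (F a) (G a),
    (forall a b (f : hom a b), comp (eta b) (fmap F f) = comp (fmap G f) (eta a))
    /\ (forall a, is_iso (eta a)).

Definition is_equivalence (C D : category) (F : functor C D) : Prop :=
  exists G : functor D C,
    nat_isomorphic (functor_comp G F) (functor_id C) /\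
    nat_isomorphic (functor_comp F G) (functor_id D).

Definition equivalent_categories (C D : category) : Prop :=
  exists F : functor C D, is_equivalence F.

(** Right modules over the underlying ring of [A]: no [k]-structure is imposed.
    When [A] has local units, as Leavitt path algebras do, a unital module has
    exactly one compatible [k]-structure and module maps are [k]-linear. *)
Record umod (k : comPzRingType) (A : nuAlgType k) := UMod {
  umod_sort :> zmodType;
  act : umod_sort -> A -> umod_sort;
  actDl : forall m n a, act (m + n) a = act m a + act n a;
  actDr : forall m a b, act m (a + b) = act m a + act m b;
  actM : forall m a b, act m (a ** b) = act (act m a) b;
  act_unital : forall m, exists s : seq (umod_sort * A),
    m = \sum_(p <- s) act p.1 p.2
}.

Lemma act0l (k : comPzRingType) (A : nuAlgType k) (M : umod A) a :
  act (0 : M) a = 0.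
Proof. by apply: (addrI (act 0 a)); rewrite -actDl !addr0. Qed.

Lemma act0r (k : comPzRingType) (A : nuAlgType k) (M : umod A) (m : M) :
  act m 0 = 0.
Proof. by apply: (addrI (act m 0)); rewrite -actDr !addr0. Qed.

Lemma actN (k : comPzRingType) (A : nuAlgType k) (M : umod A) (m : M) a :
  act (- m) a = - act m a.
Proof. by apply: (addrI (act m a)); rewrite -actDl !subrr act0l. Qed.

Section ModuleCategory.
Variables (k : comPzRingType) (A : nuAlgType k).

Record umod_hom (M N : umod A) := UModHom {
  uhom_fun :> M -> N;
  uhomD : forall m n, uhom_fun (m + n) = uhom_fun m + uhom_fun n;
  uhom_act : forall m a, uhom_fun (act m a) = act (uhom_fun m) a
}.

Lemma umod_hom_eq (M N : umod A) (f g : umod_hom M N) : f =1 g -> f = g.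
Proof.
case: f g => [f fD fA] [g gD gA] /= /funext fg; subst g.
by congr UModHom; exact: Prop_irrelevance.
Qed.

Definition umod_idm (M : umod A) : umod_hom M M :=
  @UModHom M M id (fun _ _ => erefl) (fun _ _ => erefl).

Lemma umod_compD (M N P : umod A) (f : umod_hom N P) (g : umod_hom M N) m n :
  f (g (m + n)) = f (g m) + f (g n).
Proof. by rewrite !uhomD. Qed.

Lemma umod_comp_act (M N P : umod A) (f : umod_hom N P) (g : umod_hom M N) m a :
  f (g (act m a)) = act (f (g m)) a.
Proof. by rewrite !uhom_act. Qed.

Definition umod_comp (M N P : umod A) (f : umod_hom N P) (g : umod_hom M N) :
    umod_hom M P :=
  @UModHom M P (fun m => f (g m)) (umod_compD f g) (umod_comp_act f g).

Lemma umod_comp_idl (M N : umod A) (f : umod_hom M N) :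
  umod_comp (umod_idm N) f = f.
Proof. exact: umod_hom_eq. Qed.

Lemma umod_comp_idr (M N : umod A) (f : umod_hom M N) :
  umod_comp f (umod_idm M) = f.
Proof. exact: umod_hom_eq. Qed.

Lemma umod_compA (M N P Q : umod A) (f : umod_hom P Q) (g : umod_hom N P)
    (h : umod_hom M N) :
  umod_comp f (umod_comp g h) = umod_comp (umod_comp f g) h.
Proof. exact: umod_hom_eq. Qed.

Definition Mod : category :=
  Category umod_comp_idl umod_comp_idr umod_compA.

End ModuleCategory.

Definition morita_equivalent (k : comPzRingType) (A B : nuAlgType k) : Prop :=
  equivalent_categories (Mod A) (Mod B).

(** The images of the ghost arrows say that [phi] is compatible with the
    involutions. Being prescribed on generators, such a [phi] is unique. *)
Definition reduction_hom (k : comPzRingType) (G L : digraph)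
    (iota : vert L -> vert G) (lab : arrow L -> seq (arrow G))
    (phi : nuhom (leavitt k L) (leavitt k G)) : Prop :=
  [/\ forall u, phi (lvert k u) = lvert k (iota u),
      forall e, phi (larrow k e) = lpath k (iota (src e)) (lab e)
    & forall e, phi (lghost k e) = lpath_star k (iota (src e)) (lab e)].

Lemma reduction_hom_vert (k : comPzRingType) (G L : digraph)
    (iota : vert L -> vert G) (lab : arrow L -> seq (arrow G))
    (phi : nuhom (leavitt k L) (leavitt k G)) :
  reduction_hom iota lab phi -> forall u, phi (lvert k u) = lvert k (iota u).
Proof. by case. Qed.

Section Restriction.
Variables (k : comPzRingType) (G L : digraph).
Variables (iota : vert L -> vert G).
Variable phi : nuhom (leavitt k L) (leavitt k G).
Hypothesis phi_vert : forall u, phi (lvert k u) = lvert k (iota u).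

Section RestrictionObject.
Variable M : umod (leavitt k G).

(** The subgroup $\bigoplus_u M u$ of $M$, for [u] in [vert L]; the sum is direct
    because distinct vertices are orthogonal idempotents. *)
Definition restr_set : set M :=
  [set m | exists s : seq (M * vert L),
     m = \sum_(p <- s) act p.1 (lvert k (iota p.2))].

Definition restr_pred : {pred M} := fun m => `[< restr_set m >].

Lemma restr_zmod_closed : zmod_closed restr_pred.
Proof.
split=> [|x y /asboolP[s ->] /asboolP[t ->]].
  by apply/asboolP; exists [::]; rewrite big_nil.
apply/asboolP; exists (s ++ [seq (- p.1, p.2) | p <- t]).
rewrite big_cat big_map /= -sumrN; congr (_ + _).
by apply: eq_bigr => p _; rewrite actN.
Qed.

HB.instance Definition _ := GRing.isZmodClosed.Build M restr_pred
  restr_zmod_closed.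

Record restr := Restr { restr_val : M; restr_valP : restr_val \in restr_pred }.

HB.instance Definition _ := [isSub for restr_val].
HB.instance Definition _ := [Choice of restr by <:].
HB.instance Definition _ := [SubChoice_isSubZmodule of restr by <:].

Lemma restr_act_closed (m : M) (a : leavitt k L) : act m (phi a) \in restr_pred.
Proof.
apply/asboolP; have [s ->] := leavitt_sum_vert a.
exists [seq (act m (phi p.1), p.2) | p <- s].
rewrite big_map raddf_sum (big_morph _ (actDr m) (act0r m)).
by apply: eq_bigr => p _; rewrite /= nuhomM phi_vert actM.
Qed.

Definition restr_act (m : restr) (a : leavitt k L) : restr :=
  Restr (restr_act_closed (restr_val m) a).

Lemma restr_actDl m n a : restr_act (m + n) a = restr_act m a + restr_act n a.
Proof. by apply: val_inj; rewrite /= actDl. Qed.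

Lemma restr_actDr m a b : restr_act m (a + b) = restr_act m a + restr_act m b.
Proof. by apply: val_inj; rewrite /= raddfD actDr. Qed.

Lemma restr_actM m a b : restr_act m (a ** b) = restr_act (restr_act m a) b.
Proof. by apply: val_inj; rewrite /= nuhomM actM. Qed.

Lemma restr_unital (m : restr) : exists s : seq (restr * leavitt k L),
  m = \sum_(p <- s) restr_act p.1 p.2.
Proof.
have mem1 (n : M) (u : vert L) : act n (lvert k (iota u)) \in restr_pred.
  by apply/asboolP; exists [:: (n, u)]; rewrite big_seq1.
have /asboolP[s ms] := restr_valP m.
exists [seq (Restr (mem1 p.1 p.2), lvert k p.2) | p <- s].
apply: val_inj; rewrite big_map raddf_sum [LHS]ms.
by apply: eq_bigr => p _; rewrite /= phi_vert -actM lvert_id.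
Qed.

Definition restr_umod : umod (leavitt k L) :=
  UMod restr_actDl restr_actDr restr_actM restr_unital.

End RestrictionObject.

Section RestrictionMorphism.
Variables (M N : umod (leavitt k G)) (f : umod_hom M N).

Lemma restr_map_closed (m : restr_umod M) : f (restr_val m) \in @restr_pred N.
Proof.
have f0 : f 0 = 0 by apply: (addrI (f 0)); rewrite -uhomD !addr0.
have /asboolP[s ->] := restr_valP m; apply/asboolP.
exists [seq (f p.1, p.2) | p <- s].
rewrite big_map (big_morph f (uhomD f) f0).
by apply: eq_bigr => p _; rewrite uhom_act.
Qed.

Definition restr_map (m : restr_umod M) : restr_umod N :=
  Restr (restr_map_closed m).

Lemma restr_mapD m n : restr_map (m + n) = restr_map m + restr_map n.
Proof. by apply: val_inj; rewrite /= uhomD. Qed.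

Lemma restr_map_act m a : restr_map (act m a) = act (restr_map m) a.
Proof. by apply: val_inj; rewrite /= uhom_act. Qed.

Definition restr_hom : umod_hom (restr_umod M) (restr_umod N) :=
  UModHom restr_mapD restr_map_act.

End RestrictionMorphism.

Lemma restr_hom_id (M : umod (leavitt k G)) :
  restr_hom (umod_idm M) = umod_idm (restr_umod M).
Proof. by apply: umod_hom_eq => m; exact: val_inj. Qed.

Lemma restr_hom_comp (M N P : umod (leavitt k G)) (f : umod_hom N P)
    (g : umod_hom M N) :
  restr_hom (umod_comp f g) = umod_comp (restr_hom f) (restr_hom g).
Proof. by apply: umod_hom_eq => m; exact: val_inj. Qed.

Definition restriction : functor (Mod (leavitt k G)) (Mod (leavitt k L)) :=
  @Functor (Mod (leavitt k G)) (Mod (leavitt k L))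
    restr_umod restr_hom restr_hom_id restr_hom_comp.

End Restriction.

(* Main.v *)
(** One reduction step at [v] suffices. The idempotent [e], the (possibly
    infinite) sum of the vertices other than [v], is full because
    [v = \sum_g g g*] over the arrows [g] out of [v], none of which ends at [v];
    and the corner [e A e] is spanned by the image of [phi], since [A] multiplies
    like matrices indexed by [e] and the arrows out of [v], with entries
    in that image. Conversely these matrices, with entries taken in the algebra
    [B] of the reduced graph, carry a homomorphism [psi] from [A] such that
    [psi (phi b)] is [b] placed in one diagonal entry. Hence [phi] is injective,
    and letting [A] act through [psi] on tuples of elements of a [B]-module [N]
    gives an [A]-module restricting to [N]. With fullness and the description of
    the corner this makes restriction fully faithful and essentially surjective.
    All these properties are stable under composition of reductions. *)

Require Import Defs.
From HB Require Import structures.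
From mathcomp Require Import all_boot all_order all_algebra.
From mathcomp Require Import finmap all_classical.
Import Defs.

Set Implicit Arguments.
Unset Strict Implicit.
Unset Printing Implicit Defensive.

Import GRing.Theory.

Local Open Scope classical_set_scope.
Local Open Scope ring_scope.

(** * Nonunital algebras, Leavitt path algebras and unital modules *)

Section NUAlgebraTheory.
Variables (k : comPzRingType) (A : nuAlgType k).
Implicit Types x y : A.

Lemma numul0 x : x ** 0 = 0.
Proof. by apply: (addrI (x ** 0)); rewrite -numulDr !addr0. Qed.

Lemma nu0mul x : 0 ** x = 0.
Proof. by apply: (addrI (0 ** x)); rewrite -numulDl !addr0. Qed.

Lemma numul_sumr I (r : seq I) (P : pred I) (F : I -> A) x :
  x ** (\sum_(i <- r | P i) F i) = \sum_(i <- r | P i) x ** F i.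
Proof. exact: (big_morph _ (numulDr x) (numul0 x)). Qed.

Lemma numul_suml I (r : seq I) (P : pred I) (F : I -> A) x :
  (\sum_(i <- r | P i) F i) ** x = \sum_(i <- r | P i) F i ** x.
Proof. exact: (big_morph (numul^~ x) (fun y z => numulDl y z x) (nu0mul x)). Qed.

End NUAlgebraTheory.

Section NUHomTheory.
Variables (k : comPzRingType).

Definition nuhom_id (A : nuAlgType k) : nuhom A A :=
  @NUHom k A A idfun (fun _ _ => erefl).

Lemma nuhom_comp_mul (A B C : nuAlgType k) (f : nuhom B C) (g : nuhom A B) :
  {morph (f \o g : {linear A -> C}) : x y / x ** y}.
Proof. by move=> x y; rewrite /= !nuhomM. Qed.

Definition nuhom_comp (A B C : nuAlgType k) (f : nuhom B C) (g : nuhom A B) :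
  nuhom A C := NUHom (nuhom_comp_mul f g).

Lemma nuhom_compE (A B C : nuAlgType k) (f : nuhom B C) (g : nuhom A B) a :
  nuhom_comp f g a = f (g a).
Proof. by []. Qed.

Lemma nuhom0 (A B : nuAlgType k) (f : nuhom A B) : f 0 = 0.
Proof. exact: raddf0. Qed.

Lemma nuhomD (A B : nuAlgType k) (f : nuhom A B) a b : f (a + b) = f a + f b.
Proof. exact: raddfD. Qed.

Lemma nuhomZ (A B : nuAlgType k) (f : nuhom A B) c a : f (c *: a) = c *: f a.
Proof. exact: linearZ. Qed.

End NUHomTheory.

(** * Universal property of presented algebras *)

Section UniversalProperty.
Variables (k : comPzRingType) (X : Type) (R : expr k X -> expr k X -> Prop).
Variables (C : nuAlgType k) (g : X -> C).

Fixpoint eval (x : expr k X) : C :=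
  match x with
  | Gen i => g i
  | Zero => 0
  | Add y z => eval y + eval z
  | Opp y => - eval y
  | Scale c y => c *: eval y
  | Mul y z => eval y ** eval z
  end.

Lemma eval_sum I (r : seq I) (F : I -> expr k X) :
  eval (\big[@Add k X/Zero]_(i <- r) F i) = \sum_(i <- r) eval (F i).
Proof. exact: (big_morph eval). Qed.

Hypothesis g_rel : forall x y, R x y -> eval x = eval y.

Lemma eval_congr x y : congr_of R x y -> eval x = eval y.
Proof.
elim=> {x y} //=.
- by move=> y x z _ -> _ ->.
- by move=> x x' y y' _ -> _ ->.
- by move=> x x' _ ->.
- by move=> c x x' _ ->.
- by move=> x x' y y' _ -> _ ->.
- by move=> x y z; rewrite addrA.
- by move=> x y; rewrite addrC.
- by move=> x; rewrite add0r.
- by move=> x; rewrite addNr.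
- by move=> a b x; rewrite scalerA.
- by move=> x; rewrite scale1r.
- by move=> a x y; rewrite scalerDr.
- by move=> a b x; rewrite scalerDl.
- by move=> x y z; rewrite numulA.
- by move=> x y z; rewrite numulDl.
- by move=> x y z; rewrite numulDr.
- by move=> c x y; rewrite nuscaleAl.
- by move=> c x y; rewrite nuscaleAr.
Qed.

(** Evaluates the chosen representative of the class; by [eval_congr] the choice is immaterial. *)
Definition lift_fun (a : presented R) : C := eval (pres_repr a).

Lemma lift_fun_pres x : lift_fun (pres R x) = eval x.
Proof. exact/eval_congr/pres_repr_congr. Qed.

Lemma lift_fun_linear : linear lift_fun.
Proof.
move=> c a b; elim/presW: a => x; elim/presW: b => y.
by rewrite -presZ -presD !lift_fun_pres.
Qed.

HB.instance Definition _ :=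
  GRing.isLinear.Build k (presented R) C _ lift_fun lift_fun_linear.

Lemma lift_funM : {morph lift_fun : x y / x ** y}.
Proof.
move=> a b; elim/presW: a => x; elim/presW: b => y.
by rewrite -presM !lift_fun_pres.
Qed.

Definition presented_lift : nuhom (presented R) C :=
  @NUHom k (presented R) C lift_fun lift_funM.

Lemma presented_liftE x : presented_lift (pres R x) = eval x.
Proof. exact: lift_fun_pres. Qed.

End UniversalProperty.

(** * Products of generators, local units and paths in Leavitt path algebras *)

Section LeavittTheory.
Variables (k : comPzRingType) (G : digraph).
Local Notation A := (leavitt k G).
Local Notation V := (@lvert k G).
Local Notation E := (@larrow k G).
Local Notation S := (@lghost k G).

Lemma leavitt_ind (P : A -> Prop) :
  (forall v, P (V v)) -> (forall e, P (E e)) -> (forall e, P (S e)) ->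
  P 0 -> (forall a b, P a -> P b -> P (a + b)) ->
  (forall c a, P a -> P (c *: a)) -> (forall a b, P a -> P b -> P (a ** b)) ->
  forall a, P a.
Proof.
move=> PV PE PS P0 PD PZ PM; elim/presW.
elim=> [[v|e|e]||x Px y Py|x Px|c x Px|x Px y Py]; [exact: PV| exact: PE|
  exact: PS| by rewrite pres0| by rewrite presD; apply: PD| |
  by rewrite presZ; apply: PZ| by rewrite presM; apply: PM].
by rewrite presN -scaleN1r; apply: PZ.
Qed.

Lemma larrow_src e : V (src e) ** E e = E e.
Proof. rewrite -presM; apply/pres_eqP; exact/cg_rel/lpa_E_src. Qed.

Lemma lghost_src e : V (tgt e) ** S e = S e.
Proof. rewrite -presM; apply/pres_eqP; exact/cg_rel/lpa_S_src. Qed.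

Lemma lghost_arrow e f : S e ** E f = if e == f then V (tgt e) else 0.
Proof.
rewrite -presM; have /pres_eqP -> := cg_rel (lpa_CK1 k e f); by case: ifP.
Qed.

Lemma lvert_arrow w e : V w ** E e = if w == src e then E e else 0.
Proof.
by rewrite -[in LHS]larrow_src numulA lvertM; case: eqP => [->|_];
  rewrite ?larrow_src ?nu0mul.
Qed.

Lemma larrow_vert e w : E e ** V w = if tgt e == w then E e else 0.
Proof.
by rewrite -[in LHS]larrow_tgt -numulA lvertM; case: eqP => _;
  rewrite ?larrow_tgt ?numul0.
Qed.

Lemma lvert_ghost w e : V w ** S e = if w == tgt e then S e else 0.
Proof.
by rewrite -[in LHS]lghost_src numulA lvertM; case: eqP => [->|_];
  rewrite ?lghost_src ?nu0mul.
Qed.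

Lemma lghost_vert e w : S e ** V w = if src e == w then S e else 0.
Proof.
by rewrite -[in LHS]lghost_tgt -numulA lvertM; case: eqP => _;
  rewrite ?lghost_tgt ?numul0.
Qed.

Lemma larrow_arrow0 e f : tgt e != src f -> E e ** E f = 0.
Proof.
by move=> ef; rewrite -(larrow_src f) numulA larrow_vert (negbTE ef) nu0mul.
Qed.

Lemma lghost_ghost0 e f : src e != tgt f -> S e ** S f = 0.
Proof.
by move=> ef; rewrite -(lghost_src f) numulA lghost_vert (negbTE ef) nu0mul.
Qed.

Lemma pres_sum I (r : seq I) (F : I -> expr k (lpa_gen G)) :
  pres (@lpa_rel k G) (\big[@Add k _/Zero]_(i <- r) F i) =
  \sum_(i <- r) (pres (@lpa_rel k G) (F i) : A).
Proof. by apply: big_morph => // x y; rewrite presD. Qed.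

Lemma lvert_CK2 v : finite_set (out v) -> ~ sink v ->
  V v = \sum_(e <- fset_set (out v)) E e ** S e.
Proof.
move=> fv sv; rewrite {1}/lvert; have /pres_eqP -> := cg_rel (lpa_CK2 k fv sv).
by rewrite pres_sum; apply: eq_bigr => e _; rewrite presM.
Qed.

(** With infinitely many vertices [A] need not have an identity; these idempotents serve as local
    units. *)
Definition loc_unit (r : {fset vert G}) : A := \sum_(v <- r) V v.

Lemma lvert_loc_unit v (r : {fset vert G}) :
  V v ** loc_unit r = if v \in r then V v else 0.
Proof.
rewrite numul_sumr; case: ifPn => vr.
  rewrite (big_fsetD1 v) //= lvert_id big_seq big1 ?addr0 // => w.
  by rewrite !inE lvertM eq_sym => /andP[/negbTE ->].
rewrite big_seq big1 // => w wr; rewrite lvertM; case: eqP => // vw.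
by rewrite vw wr in vr.
Qed.

(** Write [a] as a sum of terms ending in vertices and collect those vertices. Allowing every larger
    [r'] lets several elements share one unit. *)
Lemma loc_unitP (a : A) : exists r : {fset vert G},
  forall r', (r `<=` r')%fset -> a ** loc_unit r' = a.
Proof.
have [s ->] := leavitt_sum_vert a; exists [fset p.2 | p in s]%fset => r' rr'.
rewrite numul_suml big_seq [RHS]big_seq; apply: eq_bigr => p ps.
rewrite -numulA lvert_loc_unit; case: ifPn => // /negP[].
by apply: (fsubsetP rr'); apply/imfsetP; exists p.
Qed.

Lemma loc_unit2P (a b : A) :
  exists r, a ** loc_unit r = a /\ b ** loc_unit r = b.
Proof.
have [r ra] := loc_unitP a; have [r' rb] := loc_unitP b.
exists (r `|` r')%fset; split; [apply: ra | apply: rb].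
  exact: fsubsetUl.
exact: fsubsetUr.
Qed.

(** The initial vertex of a path is absorbed by [x]; this is how the labels of two composable arrows
    concatenate. *)
Lemma lpath_cat (x : A) u p : x ** V u = x ->
  x ** lpath k u p = foldl (fun x e => x ** E e) x p.
Proof.
move=> xu; rewrite /lpath -[in RHS]xu; elim/last_ind: p => [//|p e IH].
by rewrite !foldl_rcons numulA IH.
Qed.

Lemma lpath_star_cat (x : A) u p : V u ** x = x ->
  lpath_star k u p ** x = foldl (fun x e => S e ** x) x p.
Proof.
move=> xu; rewrite /lpath_star -[in RHS]xu; elim/last_ind: p => [//|p e IH].
by rewrite !foldl_rcons -numulA IH.
Qed.

End LeavittTheory.

Section UnitalModules.
Variables (k : comPzRingType) (B : nuAlgType k).

Lemma act_sumr (M : umod B) I (r : seq I) (P : pred I) (F : I -> B) (m : M) :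
  act m (\sum_(i <- r | P i) F i) = \sum_(i <- r | P i) act m (F i).
Proof. exact: (big_morph _ (actDr m) (act0r m)). Qed.

Lemma act_suml (M : umod B) I (r : seq I) (P : pred I) (F : I -> M) (a : B) :
  act (\sum_(i <- r | P i) F i) a = \sum_(i <- r | P i) act (F i) a.
Proof.
exact: (big_morph (fun m => act m a) (fun x y => actDl x y a) (act0l M a)).
Qed.

Lemma uhom0 (M N : umod B) (f : umod_hom M N) : f 0 = 0.
Proof. by apply: (addrI (f 0)); rewrite -uhomD !addr0. Qed.

End UnitalModules.

(** In a finite sum of terms [act n a], one local unit can fix all the coefficients [a] on the
    right. The induction merges the head coefficient with an element fixing the tail. *)
Lemma umod_loc_unit (k : comPzRingType) (G : digraph)
    (M : umod (leavitt k G)) (m : M) :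
  exists a : leavitt k G, act m a = m.
Proof.
have [s ->] := act_unital m; elim: s => [|[n a] s [b sb]].
  by exists 0; rewrite big_nil act0r.
have [r [ra rb]] := loc_unit2P a b; exists (loc_unit k r).
rewrite big_cons actDl /= -actM ra; congr (_ + _).
by rewrite -sb -actM rb.
Qed.

(** * Restriction to a full corner *)

Section CategoryTheory.
Variables (C D : category) (F : functor C D).

Definition faithful := forall a b (f g : hom a b), fmap F f = fmap F g -> f = g.
Definition full := forall a b (g : hom (F a) (F b)), exists f, fmap F f = g.
Definition ess_surj := forall d, exists c (f : hom (F c) d), is_iso f.

(** The inverse functor chooses a preimage of each object and conjugates morphisms by the chosen
    isomorphisms. Fullness lifts the conjugates, and faithfulness allows every equation to be
    checked after applying [F]. *)
Lemma fully_faithful_equivalence :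
  faithful -> full -> ess_surj -> is_equivalence F.
Proof.
move=> Ff Fu Fe.
(* The object and both directions of the isomorphism are packed together, so that one choice yields
   all the data. *)
have inverse_image d : {p : {c & (hom (F c) d * hom d (F c))%type} |
    comp (projT2 p).2 (projT2 p).1 = idm _ /\
    comp (projT2 p).1 (projT2 p).2 = idm _}.
  by apply: cid; have [c [f [h fh]]] := Fe d; exists (existT _ c (f, h)).
pose g d := sval (inverse_image d).
have gP d := svalP (inverse_image d).
pose Go d := projT1 (g d).
pose e d : hom (F (Go d)) d := (projT2 (g d)).1.
pose e' d : hom d (F (Go d)) := (projT2 (g d)).2.
have e'e d : comp (e' d) (e d) = idm _ by have [] := gP d.
have ee' d : comp (e d) (e' d) = idm _ by have [] := gP d.
pose inv a b (h : hom (F a) (F b)) := projT1 (cid (Fu a b h)).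
have invK a b (h : hom (F a) (F b)) : fmap F (inv a b h) = h.
  by rewrite /inv; case: cid.
pose Gm d d' (h : hom d d') := inv _ _ (comp (e' d') (comp h (e d))).
have Gid d : Gm _ _ (idm d) = idm (Go d).
  by apply: Ff; rewrite invK comp_idl e'e fmap_id.
have Gcomp a b c (h : hom b c) (h' : hom a b) :
    Gm _ _ (comp h h') = comp (Gm _ _ h) (Gm _ _ h').
  apply: Ff; rewrite fmap_comp !invK -!compA; congr comp; congr comp.
  by rewrite (compA (e b)) ee' comp_idl.
pose H := @Functor D C Go Gm Gid Gcomp.
exists H; split.
  (* The unit at [a] is the lift along [F] of the chosen isomorphism onto [F a]. *)
  exists (fun a => inv (Go (F a)) a (e (F a))); split=> [a b f|a] /=.
    apply: Ff; rewrite !fmap_comp !invK compA ee' comp_idl.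
    by [].
  exists (inv _ _ (e' (F a))); split; apply: Ff.
    by rewrite fmap_comp !invK e'e fmap_id.
  by rewrite fmap_comp !invK ee' fmap_id.
exists e; split=> [a b f|a] /=; first by rewrite invK compA ee' comp_idl.
by exists (e' a).
Qed.

End CategoryTheory.

Lemma bijective_umod_inv (k : comPzRingType) (A : nuAlgType k) (M N : umod A)
    (f : umod_hom M N) : injective f -> (forall n, exists m, f m = n) ->
  exists2 g : hom (N : obj (Mod A)) M, is_iso g & forall m, g (f m) = m.
Proof.
move=> finj /choice[g fg].
have gD m n : g (m + n) = g m + g n by apply: finj; rewrite uhomD !fg.
have gA m a : g (act m a) = act (g m) a by apply: finj; rewrite uhom_act !fg.
exists (UModHom gD gA) => [|m]; last by apply: finj; rewrite fg.
exists f; split; apply: umod_hom_eq => m /=; first exact: fg.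
by apply: finj; rewrite fg.
Qed.

Section RestrictionEquivalence.
Variables (k : comPzRingType) (G L : digraph) (iota : vert L -> vert G).
Local Notation A := (leavitt k G).
Local Notation B := (leavitt k L).
Variable phi : nuhom B A.
Local Notation V := (@lvert k G).

(** With [e] the formal sum of the vertices [iota u], this is fullness [A = A e A], tested on
    vertices because [e] need not exist in [A]. *)
Definition full_vertices :=
  forall w, exists s : seq (A * vert L * A),
    V w = \sum_(p <- s) p.1.1 ** V (iota p.1.2) ** p.2.

(** Entrywise form of the inclusion of the corner [e A e] in the image of [phi]. *)
Definition corner_in_range := forall u a u', exists b,
  phi b = V (iota u) ** a ** V (iota u').

(** The clauses say that [f] identifies [N] with the restriction of [M]. Stated without the
    restriction functor, the property composes directly along successive reductions. *)
Definition modules_extend := forall N : umod B, exists (M : umod A) (f : N -> M),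
  [/\ forall m n, f (m + n) = f m + f n,
      injective f,
      forall n b, f (act n b) = act (f n) (phi b)
    & forall m u, exists n, act m (V (iota u)) = f n].

Hypothesis phi_vert : forall u, phi (lvert k u) = V (iota u).
Hypothesis iota_full : full_vertices.
Hypothesis phi_corner : corner_in_range.

Local Notation res := (restr_umod phi_vert).

Lemma restr_mem (M : umod A) (m : M) u :
  act m (V (iota u)) \in @restr_pred _ _ _ iota M.
Proof. by apply/asboolP; exists [:: (m, u)]; rewrite big_seq1. Qed.

Lemma restr_val_sum (M : umod A) I (r : seq I) (F : I -> res M) :
  restr_val (\sum_(i <- r) F i) = \sum_(i <- r) restr_val (F i).
Proof. exact: (big_morph (@restr_val _ _ _ iota M)). Qed.

(** Some element of [A] fixes [m]; it is a sum of terms ending in vertices, and fullness makes each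
    vertex pass through some [iota u]. *)
Lemma restr_generates (M : umod A) (m : M) :
  exists s : seq (res M * A), m = \sum_(p <- s) act (restr_val p.1) p.2.
Proof.
pose P (m : M) :=
  exists s : seq (res M * A), m = \sum_(p <- s) act (restr_val p.1) p.2.
have Psum I (r : seq I) (F : I -> M) : (forall i, P (F i)) ->
    P (\sum_(i <- r) F i).
  move=> PF; apply: big_ind => //; first by exists [::]; rewrite big_nil.
  by move=> x y [s ->] [t ->]; exists (s ++ t); rewrite big_cat.
have [a <-] := umod_loc_unit m; have [s ->] := leavitt_sum_vert a.
rewrite act_sumr; apply: (Psum) => -[b w] /=.
have [t ->] := iota_full w; rewrite numul_sumr act_sumr.
apply: Psum => -[[c u] d] /=; rewrite -!numulA 2!actM -actM.
exists [:: (Restr (restr_mem (act m (b ** c)) u) : res M, d)].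
by rewrite big_seq1 /= -!actM !numulA.
Qed.

(** Since [b] is a sum of terms ending in vertices of [L], [phi b] may replace the left vertex in
    [corner_in_range]. *)
Lemma corner_range a b u : exists b', phi b' = phi b ** a ** V (iota u).
Proof.
have [s ->] := leavitt_sum_vert b.
have /choice[f fE] (p : B * vert L) := phi_corner p.2 a u.
exists (\sum_(p <- s) p.1 ** f p); rewrite !raddf_sum !numul_suml.
by apply: eq_bigr => p _; rewrite /= !nuhomM fE phi_vert !numulA.
Qed.

(** Fullness in the form used to prove equalities: an element is detected by its products landing in
    the restricted module. *)
Lemma annihilated0 (M : umod A) (m : M) :
  (forall a u, act m (a ** V (iota u)) = 0) -> m = 0.
Proof.
move=> m0; have [a <-] := umod_loc_unit m; have [s ->] := leavitt_sum_vert a.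
rewrite act_sumr big1 // => -[b w] _ /=; have [t ->] := iota_full w.
rewrite numul_sumr act_sumr big1 // => -[[c u] d] _ /=.
by rewrite !numulA actM m0 act0l.
Qed.

Lemma restriction_faithful : faithful (restriction phi_vert).
Proof.
move=> M N f g fg; apply: umod_hom_eq => m.
have [s ->] := restr_generates m.
rewrite !(big_morph _ (uhomD _) (uhom0 _)); apply: eq_bigr => p _.
rewrite !uhom_act; congr act.
by have /(congr1 (fun h : umod_hom (res M) (res N) => restr_val (h p.1))) := fg.
Qed.

Section Full.
Variables (M N : umod A) (f : umod_hom (res M) (res N)).

(** The graph of the only possible extension of [f] to [M]. As a relation it is available before
    well-definedness, which is [rel_fun]. *)
Let rel (m : M) (n : N) := exists s : seq (res M * A),
  m = \sum_(p <- s) act (restr_val p.1) p.2 /\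
  n = \sum_(p <- s) act (restr_val (f p.1)) p.2.

Let rel_total m : exists n, rel m n.
Proof.
have [s ms] := restr_generates m.
by exists (\sum_(p <- s) act (restr_val (f p.1)) p.2), s.
Qed.

Let relB m n m' n' : rel m n -> rel m' n' -> rel (m - m') (n - n').
Proof.
move=> [s [-> ->]] [t [-> ->]]; exists (s ++ [seq (- p.1, p.2) | p <- t]).
have fN x : f (- x) = - f x by apply: (addrI (f x)); rewrite -uhomD !subrr uhom0.
rewrite !big_cat !big_map /= -!sumrN; split; congr (_ + _).
  by apply: eq_bigr => p _; rewrite -actN.
by apply: eq_bigr => p _; rewrite fN -actN.
Qed.

Let rel_act m n a : rel m n -> rel (act m a) (act n a).
Proof.
move=> [s [-> ->]]; exists [seq (p.1, p.2 ** a) | p <- s].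
rewrite !big_map !act_suml /=.
by split; apply: eq_bigr => p _; rewrite actM.
Qed.

(** Multiplication by [a ** V (iota u)] moves a related pair into the restricted modules, where it
    has to be matched by [f] itself. *)
Let rel_val a u (m : M) (n : N) : rel m n -> exists r : res M,
  restr_val r = act m (a ** V (iota u)) /\
  restr_val (f r) = act n (a ** V (iota u)).
Proof.
move=> [s [-> ->]].
have step (p : res M * A) : exists r : res M,
    restr_val r = act (act (restr_val p.1) p.2) (a ** V (iota u)) /\
    restr_val (f r) = act (act (restr_val (f p.1)) p.2) (a ** V (iota u)).
  case: p => r b /=; have [c rc] := umod_loc_unit r.
  have [b' b'E] := corner_range (b ** a) c u.
  have rr : act (restr_val r) (phi c) = restr_val r by rewrite -[in RHS]rc.
  have fr : act (restr_val (f r)) (phi c) = restr_val (f r).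
    by rewrite -[in RHS]rc uhom_act.
  exists (act r b'); rewrite uhom_act /= b'E.
  by rewrite -[in RHS]rr -[in X in _ /\ _ = X]fr -!actM !numulA.
have /choice[g gP] := step.
exists (\sum_(p <- s) g p); rewrite (big_morph _ (uhomD _) (uhom0 _)).
rewrite !restr_val_sum !act_suml.
by split; apply: eq_bigr => p _; case: (gP p).
Qed.

(** By subtraction it suffices to treat an [n] related to 0. By [rel_val] all its products into the
    restriction equal [f 0], so [annihilated0] applies. *)
Let rel_fun m n n' : rel m n -> rel m n' -> n = n'.
Proof.
move=> mn mn'; apply/eqP; rewrite -subr_eq0; apply/eqP.
have := relB mn mn'; rewrite subrr => {mn mn'} h.
apply: annihilated0 => a u; have [r [r0 <-]] := rel_val a u h.
rewrite act0l in r0; have -> : r = 0 by apply: val_inj.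
by rewrite uhom0.
Qed.

Lemma restr_hom_full : exists g : umod_hom M N, restr_hom phi_vert g = f.
Proof.
have /choice[g gP] := rel_total.
have gE m n : rel m n -> g m = n by move=> h; apply: rel_fun (gP m) h.
have g0 : g 0 = 0 by apply: gE; exists [::]; rewrite !big_nil.
have gB m n : g (m - n) = g m - g n by apply/gE/relB.
(* Only differences were shown compatible with [rel]; sums follow by writing [n] as [- (0 - n)]. *)
have gD m n : g (m + n) = g m + g n.
  by rewrite -[n in LHS]opprK -[- n]sub0r !gB g0 sub0r opprK.
have gA m a : g (act m a) = act (g m) a by apply/gE/rel_act.
exists (UModHom gD gA); apply: umod_hom_eq => m; apply: val_inj => /=.
(* On the restriction, [m] is the one-term sum [m phi(a)] for some [a] in [B] fixing [m]. *)
apply: gE; have [a ma] := umod_loc_unit m; exists [:: (m, phi a)].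
rewrite !big_seq1 /=; split.
  by rewrite -[in LHS]ma.
by rewrite -[in LHS]ma uhom_act.
Qed.

End Full.

(** Any [n] is fixed by some [b], so [f n] is fixed by [phi b] and lies in the restriction. The last
    clause of [modules_extend] gives surjectivity onto it. *)
Lemma restriction_ess_surj : modules_extend -> ess_surj (restriction phi_vert).
Proof.
move=> ext N; have [M [f [fD finj fA fim]]] := ext N; exists M.
have f0 : f 0 = 0 by apply: (addrI (f 0)); rewrite -fD !addr0.
have fmem n : f n \in @restr_pred _ _ _ iota M.
  have [b <-] := umod_loc_unit n; rewrite fA; exact: restr_act_closed.
pose g n : res M := Restr (fmem n).
have gD m n : g (m + n) = g m + g n by apply: val_inj; rewrite /= fD.
have gA n a : g (act n a) = act (g n) a by apply: val_inj; rewrite /= fA.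
have ginj : injective (UModHom gD gA) by move=> m n /(congr1 val) /finj.
have gsurj r : exists n, UModHom gD gA n = r.
  have /asboolP[s rs] := restr_valP r.
  have /choice[h hE] (p : M * vert L) := fim p.1 p.2.
  exists (\sum_(p <- s) h p); apply: val_inj; rewrite /= [RHS]rs.
  rewrite (big_morph f fD f0).
  by apply: eq_bigr => p _; rewrite hE.
by have [h hiso _] := bijective_umod_inv ginj gsurj; exists h.
Qed.

Lemma restriction_equivalence : modules_extend ->
  is_equivalence (restriction phi_vert).
Proof.
move=> ext; apply: fully_faithful_equivalence.
- exact: restriction_faithful.
- move=> M N f; exact: restr_hom_full.
- exact: restriction_ess_surj.
Qed.

End RestrictionEquivalence.

(** * Matrices and their action on tuples *)

Section Matrices.
Variables (k : comPzRingType) (A : nuAlgType k) (X : finType).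

Definition nmat := {ffun X * X -> A}.
HB.instance Definition _ := GRing.Lmodule.on nmat.
Implicit Types f g h : nmat.

Definition nmat_mul f g : nmat :=
  [ffun p => \sum_z f (p.1, z) ** g (z, p.2)].

Lemma nmat_mulA : associative nmat_mul.
Proof.
move=> f g h; apply/ffunP => -[x y]; rewrite !ffunE /=.
under eq_bigr do rewrite ffunE numul_sumr.
under [RHS]eq_bigr do rewrite ffunE numul_suml.
rewrite exchange_big; apply: eq_bigr => z _; apply: eq_bigr => w _ /=.
by rewrite numulA.
Qed.

Lemma nmat_mulDl : left_distributive nmat_mul +%R.
Proof.
move=> f g h; apply/ffunP => p; rewrite !ffunE -big_split.
by apply: eq_bigr => z _; rewrite ffunE numulDl.
Qed.

Lemma nmat_mulDr : right_distributive nmat_mul +%R.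
Proof.
move=> f g h; apply/ffunP => p; rewrite !ffunE -big_split.
by apply: eq_bigr => z _; rewrite ffunE numulDr.
Qed.

Lemma nmat_scaleAl c f g : c *: nmat_mul f g = nmat_mul (c *: f) g.
Proof.
apply/ffunP => p; rewrite !ffunE scaler_sumr.
by apply: eq_bigr => z _; rewrite ffunE nuscaleAl.
Qed.

Lemma nmat_scaleAr c f g : c *: nmat_mul f g = nmat_mul f (c *: g).
Proof.
apply/ffunP => p; rewrite !ffunE scaler_sumr.
by apply: eq_bigr => z _; rewrite ffunE nuscaleAr.
Qed.

HB.instance Definition _ := isNUAlgebra.Build k nmat
  nmat_mulA nmat_mulDl nmat_mulDr nmat_scaleAl nmat_scaleAr.

Definition delta (x y : X) (a : A) : nmat :=
  [ffun p => if p == (x, y) then a else 0].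

Lemma deltaD x y : {morph delta x y : a b / a + b}.
Proof.
by move=> a b; apply/ffunP => p; rewrite !ffunE; case: ifP; rewrite ?addr0.
Qed.

Lemma delta0 x y : delta x y 0 = 0.
Proof. by apply/ffunP => p; rewrite !ffunE if_same. Qed.

Lemma deltaZ x y c a : delta x y (c *: a) = c *: delta x y a.
Proof.
by apply/ffunP => p; rewrite !ffunE; case: ifP; rewrite ?scaler0.
Qed.

Lemma deltaM x y z w a b :
  delta x y a ** delta z w b = if y == z then delta x w (a ** b) else 0.
Proof.
apply/ffunP => -[x' y']; rewrite [LHS]ffunE /= (bigD1 y) //= big1 => [|t ty].
  rewrite addr0 !ffunE !xpair_eqE eqxx andbT.
  case: (y == z); rewrite !ffunE ?xpair_eqE /=; last by rewrite numul0.
  by case: (x' == x); case: (y' == w); rewrite /= ?numul0 ?nu0mul.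
by rewrite ffunE xpair_eqE (negbTE ty) andbF nu0mul.
Qed.

Lemma delta_inj x y : injective (delta x y).
Proof. by move=> a b /ffunP/(_ (x, y)); rewrite !ffunE eqxx. Qed.

Section Action.
Variable N : umod A.

Definition vec_act (v : {ffun X -> N}) (f : nmat) : {ffun X -> N} :=
  [ffun y => \sum_x act (v x) (f (x, y))].

Lemma vec_actDl v w f : vec_act (v + w) f = vec_act v f + vec_act w f.
Proof.
apply/ffunP => y; rewrite !ffunE -big_split.
by apply: eq_bigr => x _; rewrite ffunE actDl.
Qed.

Lemma vec_actDr v f g : vec_act v (f + g) = vec_act v f + vec_act v g.
Proof.
apply/ffunP => y; rewrite !ffunE -big_split.
by apply: eq_bigr => x _; rewrite ffunE actDr.
Qed.

Lemma vec_actM v f g : vec_act v (f ** g) = vec_act (vec_act v f) g.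
Proof.
apply/ffunP => y; rewrite !ffunE.
under eq_bigr do rewrite ffunE act_sumr.
under [RHS]eq_bigr do rewrite ffunE act_suml.
rewrite exchange_big; apply: eq_bigr => z _; apply: eq_bigr => w _ /=.
by rewrite actM.
Qed.

Definition vec_at (x : X) (n : N) : {ffun X -> N} :=
  [ffun y => if y == x then n else 0].

Lemma vec_act_delta v x y a :
  vec_act v (delta x y a) = vec_at y (act (v x) a).
Proof.
apply/ffunP => z; rewrite !ffunE (bigD1 x) //= big1 => [|t tx].
  rewrite ffunE xpair_eqE eqxx addr0 /=.
  by case: ifP => // _; rewrite act0r.
by rewrite ffunE xpair_eqE (negbTE tx) act0r.
Qed.

End Action.

End Matrices.

(** * The unital part of a module that may fail to be unital *)

Section UnitalPart.
Variables (k : comPzRingType) (G : digraph) (W : zmodType).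
Local Notation A := (leavitt k G).
Variable wact : W -> A -> W.
Hypothesis wactDl : forall m n a, wact (m + n) a = wact m a + wact n a.
Hypothesis wactDr : forall m a b, wact m (a + b) = wact m a + wact m b.
Hypothesis wactM : forall m a b, wact m (a ** b) = wact (wact m a) b.

(** Because of local units, being fixed by a single element is equivalent to being a finite sum of
    products, and it is easier to test. *)
Definition unital_pred : {pred W} := fun m => `[< exists a, wact m a = m >].

Lemma unital_zmod_closed : zmod_closed unital_pred.
Proof.
have wact0 a : wact 0 a = 0 by apply: (addrI (wact 0 a)); rewrite -wactDl !addr0.
have wactN m a : wact (- m) a = - wact m a.
  by apply: (addrI (wact m a)); rewrite -wactDl !subrr wact0.
split=> [|m n /asboolP[a am] /asboolP[b bn]]; apply/asboolP.
  by exists 0; rewrite wact0.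
have [r [ra rb]] := loc_unit2P a b; exists (loc_unit k r).
by rewrite wactDl wactN -am -bn -!wactM ra rb.
Qed.

HB.instance Definition _ :=
  GRing.isZmodClosed.Build W unital_pred unital_zmod_closed.

Record unital_part := UnitalPart {
  unital_val : W; unital_valP : unital_val \in unital_pred
}.

HB.instance Definition _ := [isSub for unital_val].
HB.instance Definition _ := [Choice of unital_part by <:].
HB.instance Definition _ := [SubChoice_isSubZmodule of unital_part by <:].

Lemma unital_act_closed m a : wact m a \in unital_pred.
Proof.
apply/asboolP; have [r ra] := loc_unit2P a a; exists (loc_unit k r).
by rewrite -wactM ra.1.
Qed.

Definition unital_act (m : unital_part) (a : A) : unital_part :=
  UnitalPart (unital_act_closed (unital_val m) a).

Lemma unital_actDl m n a : unital_act (m + n) a = unital_act m a + unital_act n a.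
Proof. by apply: val_inj; rewrite /= wactDl. Qed.

Lemma unital_actDr m a b : unital_act m (a + b) = unital_act m a + unital_act m b.
Proof. by apply: val_inj; rewrite /= wactDr. Qed.

Lemma unital_actM m a b : unital_act m (a ** b) = unital_act (unital_act m a) b.
Proof. by apply: val_inj; rewrite /= wactM. Qed.

Lemma unital_act_unital (m : unital_part) : exists s : seq (unital_part * A),
  m = \sum_(p <- s) unital_act p.1 p.2.
Proof.
have /asboolP[a ma] := unital_valP m; exists [:: (m, a)].
by apply: val_inj; rewrite big_seq1 /= ma.
Qed.

Definition unital_umod : umod A :=
  UMod unital_actDl unital_actDr unital_actM unital_act_unital.

End UnitalPart.

Section MatrixExtension.
Variables (k : comPzRingType) (G L : digraph) (iota : vert L -> vert G).
Local Notation A := (leavitt k G).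
Local Notation B := (leavitt k L).
Variables (phi : nuhom B A) (X : finType) (x0 : X) (psi : nuhom A (nmat B X)).
Hypothesis phi_vert : forall u, phi (lvert k u) = lvert k (iota u).
Hypothesis psi_phi : forall b, psi (phi b) = delta x0 x0 b.

Lemma matrix_hom_inj : injective phi.
Proof. by move=> a b /(congr1 psi); rewrite !psi_phi => /delta_inj. Qed.

(** [A] acts through [psi] on tuples over [N], and [n] is placed in coordinate [x0]. Passing to the
    unital part ensures a unital module and loses no such tuple. *)
Lemma matrix_modules_extend : modules_extend iota phi.
Proof.
move=> N; pose wact (v : {ffun X -> N}) a := vec_act v (psi a).
have wactDl m n a : wact (m + n) a = wact m a + wact n a.
  by rewrite /wact vec_actDl.
have wactDr m a b : wact m (a + b) = wact m a + wact m b.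
  by rewrite /wact raddfD vec_actDr.
have wactM m a b : wact m (a ** b) = wact (wact m a) b.
  by rewrite /wact nuhomM vec_actM.
have wact_at n b : wact (vec_at x0 n) (phi b) = vec_at x0 (act n b).
  by rewrite /wact psi_phi vec_act_delta ffunE eqxx.
have at_unital n : vec_at x0 n \in unital_pred wact.
  have [b bn] := umod_loc_unit n; apply/asboolP; exists (phi b).
  by rewrite wact_at bn.
exists (unital_umod wactDl wactDr wactM), (fun n => UnitalPart (at_unital n)).
split.
- move=> m n; apply: val_inj; apply/ffunP => y; rewrite /= !ffunE.
  by case: ifP; rewrite ?addr0.
- by move=> m n /(congr1 val)/ffunP/(_ x0); rewrite /= !ffunE eqxx.
- by move=> n b; apply: val_inj; rewrite /= wact_at.
(* The image of a vertex of [L] is a diagonal unit entry at [x0], so acting by it leaves only that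
   coordinate. *)
- move=> m u; exists (act (unital_val m x0) (lvert k u)); apply: val_inj.
  by rewrite /= -phi_vert /wact psi_phi vec_act_delta.
Qed.

End MatrixExtension.

(** * The homomorphism of one reduction step *)

Section ReductionStep.
Variables (k : comPzRingType) (G : digraph) (hG : row_finite G).
Variables (v : vert G) (hv : loopless v) (sv : ~ sink v).
Local Notation L := (reduce_at hv).
Local Notation A := (leavitt k G).
Local Notation B := (leavitt k L).
Local Notation V := (@lvert k G).
Local Notation E := (@larrow k G).
Local Notation S := (@lghost k G).
Local Notation outs w := (fset_set (out w)).

Lemma loopless_tgt e : src e = v -> tgt e != v.
Proof.
by move=> ev; apply/eqP => tv; apply: (hv ev); rewrite /is_loop ev tv.
Qed.

Lemma mem_outs (e : arrow G) w : (e \in outs w) = (src e == w).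
Proof.
rewrite in_fset_set; last exact: hG.
by apply/idP/idP => [|/eqP ew]; rewrite inE // => /eqP.
Qed.

(** Arrows of [L] are obtained from those of [G] by partial functions, so that sums over arrows of
    [G] need no dependent indices. *)
Definition red_kept (e : arrow G) : option (arrow L) :=
  omap (@inl _ (path2_through v)) (insub e : option (kept_arrow v)).

Definition red_path (e g : arrow G) : option (arrow L) :=
  omap (@inr (kept_arrow v) _) (insub (e, g) : option (path2_through v)).

Lemma red_keptT e (p : (src e != v) && (tgt e != v)) :
  red_kept e = Some (inl (exist _ e p)).
Proof.
rewrite /red_kept; case: insubP => [x _ xe|]; last by rewrite p.
by congr (Some (inl _)); apply: val_inj.
Qed.

Lemma red_keptF e : ~~ ((src e != v) && (tgt e != v)) -> red_kept e = None.
Proof. by rewrite /red_kept => ne; case: insubP => //; rewrite (negbTE ne). Qed.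

Lemma red_pathT e g (p : (tgt e == v) && (src g == v)) :
  red_path e g = Some (inr (exist _ (e, g) p)).
Proof.
rewrite /red_path; case: insubP => [x _ xe|]; last by rewrite p.
by congr (Some (inr _)); apply: val_inj.
Qed.

Lemma red_pathF e g : ~~ ((tgt e == v) && (src g == v)) -> red_path e g = None.
Proof. by rewrite /red_path => ne; case: insubP => //; rewrite (negbTE ne). Qed.

(** The option records whether a second arrow is appended. Both kinds of arrows of [L] are thus
    handled by one partial bijection, with inverse [red_arrow_inv]. *)
Definition red_arrow (p : arrow G * option (arrow G)) : option (arrow L) :=
  if p.2 is Some g then red_path p.1 g else red_kept p.1.

Definition red_arrow_inv (x : arrow L) : arrow G * option (arrow G) :=
  match x with
  | inl e => (val e, None)
  | inr fg => ((val fg).1, Some (val fg).2)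
  end.

Lemma red_arrowK : ocancel red_arrow red_arrow_inv.
Proof.
move=> [e [g|]]; rewrite /red_arrow /red_path /red_kept /=.
  by case: insubP => //= fg _ ->.
by case: insubP => //= x _ ->.
Qed.

Lemma red_arrow_invK x : red_arrow (red_arrow_inv x) = Some x.
Proof.
case: x => [e|fg]; rewrite /red_arrow /red_path /red_kept /= ?valK //.
by rewrite -surjective_pairing valK.
Qed.

Lemma red_kept_val (e : kept_arrow v) : red_kept (val e) = Some (inl e).
Proof. exact: (red_arrow_invK (inl e)). Qed.

Lemma red_path_val (fg : path2_through v) :
  red_path (val fg).1 (val fg).2 = Some (inr fg).
Proof. exact: (red_arrow_invK (inr fg)). Qed.

(** An explicit listing of [out u], from which row-finiteness of [L] and the formula [sum_red_out]
    are both read. *)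
Definition red_outs (u : vert L) : seq (arrow L) :=
  pmap red_arrow
    [seq (e, o) | e <- outs (val u), o <- None :: [seq Some g | g <- outs v]].

Lemma red_outs_uniq u : uniq (red_outs u).
Proof.
apply: (pmap_uniq red_arrowK); apply: allpairs_uniq => //=.
  rewrite map_inj_uniq; last by move=> x y [].
  by rewrite fset_uniq andbT; apply/mapP => -[].
by move=> [? ?] [? ?] _ _ /= [-> ->].
Qed.

Lemma mem_red_outs u x : (x \in red_outs u) = (src x == u).
Proof.
rewrite (can2_mem_pmap red_arrowK red_arrow_invK).
apply/allpairsPdep/eqP => [[e [o [+ _ xE]]]|<-].
  rewrite mem_outs => /eqP eu; apply: val_inj; rewrite -eu.
  by case: x xE => [x|x] [<-].
case: x => [e|fg] /=.
  by exists (val e), None; split; rewrite ?mem_outs ?inE.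
have /andP[/eqP tf /eqP sg] := valP fg.
exists (val fg).1, (Some (val fg).2); split; rewrite ?mem_outs //.
by rewrite inE map_f // mem_outs sg.
Qed.

Lemma row_finite_reduce : row_finite L.
Proof.
move=> u; apply/finite_seqP; exists (red_outs u).
by apply/seteqP; split=> x /=; rewrite mem_red_outs => /eqP.
Qed.

Lemma sum_red_out (Z : nmodType) (F : arrow L -> Z) u :
  \sum_(x <- fset_set (out u)) F x =
  \sum_(e <- outs (val u)) (oapp F 0 (red_kept e) +
    \sum_(g <- outs v) oapp F 0 (red_path e g)).
Proof.
rewrite (perm_big (red_outs u)) /=.
  rewrite big_pmap big_allpairs; apply: eq_bigr => e _.
  by rewrite big_cons big_map.
apply: uniq_perm; rewrite ?fset_uniq ?red_outs_uniq // => x.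
rewrite mem_red_outs in_fset_set; last exact: row_finite_reduce.
by apply/idP/idP => [|/eqP xu]; rewrite inE // => /eqP.
Qed.

(** An arrow out of [val u] either is kept or ends at [v]; in the latter case it extends to a path,
    because [v] is not a sink. *)
Lemma red_sink u : ~ sink (val u) -> ~ sink (u : vert L).
Proof.
move=> su s; have /set0P[e /= eu] : out (val u) != set0 by apply/eqP.
have none (x : arrow L) : src x <> u.
  by move=> xu; have : out (u : vert L) x by []; rewrite s.
case: (eqVneq (tgt e) v) => [tv|tv].
  have /set0P[g /= gv] : out v != set0 by apply/eqP.
  have p : (tgt (e, g).1 == v) && (src (e, g).2 == v) by rewrite tv gv !eqxx.
  by apply: (none (inr (exist _ (e, g) p))); apply: val_inj.
have p : (src e != v) && (tgt e != v) by rewrite eu tv (valP u).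
by apply: (none (inl (exist _ e p))); apply: val_inj.
Qed.

Section Homomorphism.

Definition red_gen (x : lpa_gen L) : A :=
  match x with
  | GVert u => V (val u)
  | GArrow (inl e) => E (val e)
  | GArrow (inr fg) => E (val fg).1 ** E (val fg).2
  | GGhost (inl e) => S (val e)
  | GGhost (inr fg) => S (val fg).2 ** S (val fg).1
  end.

Lemma path2P (fg : path2_through v) :
  tgt (val fg).1 = v /\ src (val fg).2 = v.
Proof. by have /andP[/eqP ? /eqP ?] := valP fg. Qed.

(** If [e] ends at [v], inserting CK2 at [v] between [e] and its ghost turns [e e*] into the sum
    over [g] of [e g g* e*]; otherwise [e] is kept. *)
Lemma red_out_sum w : w != v ->
  \sum_(e <- outs w)
    (oapp (fun x => red_gen (GArrow x) ** red_gen (GGhost x)) 0 (red_kept e) +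
     \sum_(g <- outs v)
       oapp (fun x => red_gen (GArrow x) ** red_gen (GGhost x)) 0 (red_path e g))
  = \sum_(e <- outs w) E e ** S e.
Proof.
move=> wv; rewrite big_seq [RHS]big_seq; apply: eq_bigr => e.
rewrite mem_outs => /eqP sw; case: (eqVneq (tgt e) v) => tv.
  rewrite red_keptF ?tv ?eqxx ?andbF //= add0r.
  rewrite -[in RHS](larrow_tgt k e) tv lvert_CK2 //.
  rewrite numul_sumr numul_suml big_seq [RHS]big_seq; apply: eq_bigr => g.
  rewrite mem_outs => gv; have p : (tgt e == v) && (src g == v).
    by rewrite tv gv eqxx.
  by rewrite (red_pathT p) /= !numulA.
have p : (src e != v) && (tgt e != v) by rewrite sw wv.
rewrite (red_keptT p) /= big1 ?addr0 // => g _.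
by rewrite red_pathF //= (negbTE tv).
Qed.
Lemma red_gen_rel x y : @lpa_rel k L x y -> eval red_gen x = eval red_gen y.
Proof.
case=> {x y} /=.
- move=> u w; rewrite lvertM -val_eqE; by case: ifP.
- by case=> e /=; rewrite ?numulA larrow_src.
- by case=> e /=; rewrite -?numulA larrow_tgt.
- by case=> e /=; rewrite ?numulA lghost_src.
- by case=> e /=; rewrite -?numulA lghost_tgt.
- case=> [e|[[f g] p]] [e'|[[f' g'] p']] /=.
  + rewrite lghost_arrow (inj_eq (@inl_inj _ _)) -val_eqE; by case: ifP.
  (* The first arrow of a path through [v] ends at [v], unlike a kept arrow, so the two cannot
     coincide. *)
  + rewrite numulA lghost_arrow; case: eqP => [ef|_]; last by rewrite nu0mul.
    by have := kept_tgtP e; have /andP[/= /eqP tf _] := p'; rewrite ef tf eqxx.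
  + rewrite -numulA lghost_arrow; case: eqP => [ef|_]; last by rewrite numul0.
    by have := kept_tgtP e'; have /andP[/= /eqP tf _] := p; rewrite -ef tf eqxx.
  + have /andP[/= /eqP tf /eqP sg] := p; have /andP[/= /eqP tf' /eqP sg'] := p'.
    rewrite (inj_eq (@inr_inj _ _)) -val_eqE /= xpair_eqE numulA.
    rewrite -(numulA (S g)) lghost_arrow; case: (f == f') => /=; last first.
      by rewrite numul0 nu0mul.
    have vg' : V v ** E g' = E g' by rewrite lvert_arrow sg' eqxx.
    by rewrite -numulA tf vg' lghost_arrow; case: ifP.
- move=> u fu su; rewrite eval_sum /= sum_red_out red_out_sum ?(valP u) //.
  apply: lvert_CK2; first exact: hG.
  move=> s; apply: su.
  (* The first arrow of any arrow of [L] out of [u] starts at [val u], so a sink of [G] would remain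
     a sink of [L]. *)
  apply/seteqP; split=> // x /= xu; have := red_arrow_invK x.
  have : out (val u) (red_arrow_inv x).1 by case: x xu => x /= <-.
  by rewrite s.
Qed.

Definition red_hom : nuhom B A := presented_lift red_gen_rel.

Lemma red_hom_vert u : red_hom (lvert k u) = V (val u).
Proof. exact: presented_liftE. Qed.

Lemma red_hom_arrow x : red_hom (larrow k x) = red_gen (GArrow x).
Proof. exact: presented_liftE. Qed.

Lemma red_hom_ghost x : red_hom (lghost k x) = red_gen (GGhost x).
Proof. exact: presented_liftE. Qed.

End Homomorphism.

End ReductionStep.

(** * Fullness and the corner for one reduction step *)

Section ReductionCorner.
Variables (k : comPzRingType) (G : digraph) (hG : row_finite G).
Variables (v : vert G) (hv : loopless v) (sv : ~ sink v).
Local Notation L := (reduce_at hv).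
Local Notation A := (leavitt k G).
Local Notation V := (@lvert k G).
Local Notation E := (@larrow k G).
Local Notation S := (@lghost k G).
Local Notation outs w := (fset_set (out w)).
Local Notation phi := (red_hom k hG hv sv).

(** The retained vertices [u] and the arrows [g] out of [v] index a matrix
    picture of [A]: every vertex of [G] is a sum of terms [lcol x ** lrow x],
    and the entries [lrow x ** a ** lcol y] lie in the image of [phi]. *)
Definition lcol (x : vert L + outs v) : A :=
  match x with inl u => V (val u) | inr g => E (val g) end.

Definition lrow (x : vert L + outs v) : A :=
  match x with inl u => V (val u) | inr g => S (val g) end.

Lemma red_vertP (u : vert L) : val u != v.
Proof. exact: (valP u). Qed.

Lemma outs_src (g : outs v) : src (val g) = v.
Proof. by apply/eqP; rewrite -(mem_outs hG) (valP g). Qed.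

Lemma outs_tgt (g : outs v) : tgt (val g) != v.
Proof. exact/(loopless_tgt hv)/outs_src. Qed.

Lemma lvert_col_row w : exists s : seq (vert L + outs v),
  V w = \sum_(x <- s) lcol x ** lrow x.
Proof.
case: (eqVneq w v) => [->|wv]; last first.
  exists [:: inl (Sub w wv)].
  by rewrite big_seq1 /= lvert_id.
exists [seq inr g | g <- enum {: outs v}].
by rewrite big_map /= big_enum lvert_CK2 //= big_seq_fsetE.
Qed.

(** Only [v] needs an argument: each [g g*] in its CK2 expansion passes through the target of [g],
    which is retained since [v] is loopless. *)
Lemma red_full_vertices : full_vertices k (fun u : vert L => val u).
Proof.
move=> w; have [s ->] := lvert_col_row w.
have factor (x : vert L + outs v) :
    exists p : A * vert L * A, lcol x ** lrow x = p.1.1 ** V (val p.1.2) ** p.2.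
  case: x => [u|g]; first by exists (V (val u), u, V (val u)); rewrite /= !lvert_id.
  pose u : red_vert v := Sub (tgt (val g)) (outs_tgt g).
  by exists (E (val g), u, S (val g)); rewrite /= larrow_tgt.
have /choice[f fE] := factor.
by exists (map f s); rewrite big_map; apply: eq_bigr => x _.
Qed.

Let rng (a : A) := exists b, phi b = a.

Let rng0 : rng 0. Proof. by exists 0; rewrite raddf0. Qed.

Let rngD a b : rng a -> rng b -> rng (a + b).
Proof. by move=> [a' <-] [b' <-]; exists (a' + b'); rewrite raddfD. Qed.

Let rng_if (c : bool) a : (c -> rng a) -> rng (if c then a else 0).
Proof. by case: c => [|_]; [exact | exact: rng0]. Qed.

Let rng_vert w : w != v -> rng (V w).
Proof. by move=> wv; exists (lvert k (Sub w wv : vert L)); rewrite red_hom_vert. Qed.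

Let rng_arrow e : src e != v -> tgt e != v -> rng (E e).
Proof.
move=> se te; have p : (src e != v) && (tgt e != v) by rewrite se.
by exists (larrow k (inl (exist _ e p) : arrow L)); rewrite red_hom_arrow.
Qed.

Let rng_ghost e : src e != v -> tgt e != v -> rng (S e).
Proof.
move=> se te; have p : (src e != v) && (tgt e != v) by rewrite se.
by exists (lghost k (inl (exist _ e p) : arrow L)); rewrite red_hom_ghost.
Qed.

Let rng_path e g : src g = v -> rng (E e ** E g).
Proof.
move=> sg; case: (eqVneq (tgt e) v) => tv; last first.
  by rewrite larrow_arrow0 ?sg // ; exact: rng0.
have p : (tgt e == v) && (src g == v) by rewrite tv sg eqxx.
by exists (larrow k (inr (exist _ (e, g) p) : arrow L)); rewrite red_hom_arrow.
Qed.

Let rng_path_star e g : src g = v -> rng (S g ** S e).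
Proof.
move=> sg; case: (eqVneq (tgt e) v) => tv; last first.
  by rewrite lghost_ghost0 ?sg 1?eq_sym // ; exact: rng0.
have p : (tgt e == v) && (src g == v) by rewrite tv sg eqxx.
by exists (lghost k (inr (exist _ (e, g) p) : arrow L)); rewrite red_hom_ghost.
Qed.

Let rng_mul a b : rng a -> rng b -> rng (a ** b).
Proof. by move=> [a' <-] [b' <-]; exists (a' ** b'); rewrite nuhomM. Qed.

(** Induction on [a]. For a generator, the entry is zero or a product of images of vertices, arrows
    or ghosts of [L]; paths through [v] arise from an arrow [e] met by a column [g]. *)
Lemma row_col_range a x y : exists b, phi b = lrow x ** a ** lcol y.
Proof.
rewrite -/(rng _); elim/leavitt_ind: a x y.
- move=> w [u|g] [u'|g'] /=.
  + rewrite lvertM; case: eqP => _; last by rewrite nu0mul; exact: rng0.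
    by apply: rng_mul; apply: rng_vert; exact: red_vertP.
  + rewrite lvertM; case: eqP => _; last by rewrite nu0mul; exact: rng0.
    by rewrite lvert_arrow outs_src (negbTE (valP u)); exact: rng0.
  + rewrite -numulA lvertM; case: eqP => [->|_]; last by rewrite numul0; exact: rng0.
    by rewrite lghost_vert outs_src eq_sym (negbTE (valP u')); exact: rng0.
  + rewrite lghost_vert outs_src; case: eqP => _; last by rewrite nu0mul; exact: rng0.
    by rewrite lghost_arrow; apply: rng_if => _; apply/rng_vert/outs_tgt.
- move=> e [u|g] [u'|g'] /=.
  + rewrite lvert_arrow; case: eqP => [ue|_]; last by rewrite nu0mul; exact: rng0.
    rewrite larrow_vert; apply: rng_if => /eqP eu'.
    by apply: rng_arrow; rewrite -?ue ?eu'; exact: red_vertP.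
  + rewrite lvert_arrow; case: eqP => [ue|_]; last by rewrite nu0mul; exact: rng0.
    exact/rng_path/outs_src.
  + rewrite lghost_arrow; case: eqP => _; last by rewrite nu0mul; exact: rng0.
    by apply: rng_mul; apply: rng_vert; [exact: outs_tgt | exact: red_vertP].
  + rewrite lghost_arrow; case: eqP => _; last by rewrite nu0mul; exact: rng0.
    by rewrite lvert_arrow outs_src (negbTE (outs_tgt g)); exact: rng0.
- move=> e [u|g] [u'|g'] /=.
  + rewrite lvert_ghost; case: eqP => [ue|_]; last by rewrite nu0mul; exact: rng0.
    rewrite lghost_vert; apply: rng_if => /eqP eu'.
    by apply: rng_ghost; rewrite -?ue ?eu'; exact: red_vertP.
  + rewrite -numulA lghost_arrow; case: eqP => [->|_]; last first.
      by rewrite numul0; exact: rng0.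
    by apply: rng_mul; apply: rng_vert; [exact: red_vertP | exact: outs_tgt].
  + rewrite -numulA lghost_vert; case: eqP => _; last first.
      by rewrite numul0; exact: rng0.
    exact/rng_path_star/outs_src.
  + rewrite -numulA lghost_arrow; case: eqP => [->|_]; last first.
      by rewrite numul0; exact: rng0.
    by rewrite lghost_vert outs_src eq_sym (negbTE (outs_tgt _)); exact: rng0.
- by move=> x y; rewrite numul0 nu0mul; exact: rng0.
- by move=> a b IHa IHb x y; rewrite numulDr numulDl; exact: rngD.
- move=> c a IH x y; have [b ab] := IH x y; exists (c *: b).
  by rewrite linearZ ab /= nuscaleAl nuscaleAr.
(* As in matrix multiplication: a local unit inserted between the factors is split into terms
   [lcol z ** lrow z], giving products of entries of [a] and [b]. *)
- move=> a b IHa IHb x y; have [r rP] := loc_unitP a.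
  rewrite -(rP r) // numul_sumr numul_suml numul_sumr numul_suml.
  elim/big_ind: _ => [||w _]; [exact: rng0 | exact: rngD |].
  have [s ->] := lvert_col_row w.
  rewrite numul_sumr numul_suml numul_sumr numul_suml.
  elim/big_ind: _ => [||z _]; [exact: rng0 | exact: rngD |].
  rewrite (_ : lrow x ** _ ** _ =
    (lrow x ** a ** lcol z) ** (lrow z ** b ** lcol y)).
    exact: rng_mul.
  by rewrite !numulA.
Qed.

Lemma red_corner_in_range : corner_in_range (fun u : vert L => val u) phi.
Proof. by move=> u a u'; exact: row_col_range a (inl u) (inl u'). Qed.

End ReductionCorner.

(** * The matrix representation of one reduction step *)

Section BlockMatrices.
Variables (k : comPzRingType) (A : nuAlgType k) (X : finType).
Implicit Types (a : A) (b c : X -> A) (d : X -> X -> A).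

(** Block form with a [None] block of size one: [a] is the corner, [b] a row, [c] a column and [d]
    the square block. *)
Definition blk a b c d : nmat A (option X) :=
  [ffun p => match p with
    | (None, None) => a
    | (None, Some y) => b y
    | (Some x, None) => c x
    | (Some x, Some y) => d x y
    end].

Lemma blk_eq a b c d a' b' c' d' :
  a = a' -> b =1 b' -> c =1 c' -> d =2 d' -> blk a b c d = blk a' b' c' d'.
Proof.
by move=> -> bb cc dd; apply/ffunP => -[[x|] [y|]]; rewrite !ffunE.
Qed.

Lemma blkM a b c d a' b' c' d' : blk a b c d ** blk a' b' c' d' =
  blk (a ** a' + \sum_z b z ** c' z)
      (fun y => a ** b' y + \sum_z b z ** d' z y)
      (fun x => c x ** a' + \sum_z d x z ** c' z)
      (fun x y => c x ** b' y + \sum_z d x z ** d' z y).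
Proof.
have sum_option (F : option X -> A) : \sum_z F z = F None + \sum_z F (Some z).
  rewrite (bigD1 None) //=; congr (_ + _); rewrite (reindex_omap Some id).
    by apply: eq_bigl => z; rewrite eqxx.
  by case.
by apply/ffunP => -[[x|] [y|]]; rewrite !ffunE sum_option !ffunE;
  congr (_ + _); apply: eq_bigr => z _; rewrite !ffunE.
Qed.

Lemma blk_sum I (r : seq I) (a : I -> A) (b c : I -> X -> A)
    (d : I -> X -> X -> A) :
  \sum_(i <- r) blk (a i) (b i) (c i) (d i) =
  blk (\sum_(i <- r) a i) (fun y => \sum_(i <- r) b i y)
      (fun x => \sum_(i <- r) c i x) (fun x y => \sum_(i <- r) d i x y).
Proof.
apply/ffunP => p; rewrite sum_ffunE ffunE.
by case: p => [[x|] [y|]]; apply: eq_bigr => i _; rewrite ffunE.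
Qed.

Lemma blk0 : blk 0 (fun=> 0) (fun=> 0) (fun _ _ => 0) = 0.
Proof. by apply/ffunP => -[[x|] [y|]]; rewrite !ffunE. Qed.

Lemma blk_delta a :
  blk a (fun=> 0) (fun=> 0) (fun _ _ => 0) = delta None None a.
Proof. by apply/ffunP => -[[x|] [y|]]; rewrite !ffunE. Qed.

End BlockMatrices.

(** * The homomorphism from the algebra of [G] to matrices over that of [L] *)

Section ReductionMatrices.
Variables (k : comPzRingType) (G : digraph) (hG : row_finite G).
Variables (v : vert G) (hv : loopless v) (sv : ~ sink v).
Local Notation L := (reduce_at hv).
Local Notation B := (leavitt k L).
Local Notation outs w := (fset_set (out w)).
Local Notation phi := (red_hom k hG hv sv).

(** Contributions of vertices and paths that do not survive in [L] are [0], so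
    that the relations below hold without side conditions. *)
Definition arrow_or0 (o : option (arrow L)) : B := oapp (@larrow k L) 0 o.
Definition ghost_or0 (o : option (arrow L)) : B := oapp (@lghost k L) 0 o.
Definition vert_or0 (w : vert G) : B :=
  oapp (fun u : red_vert v => lvert k (u : vert L)) 0 (insub w).

Local Notation V := vert_or0.
Local Notation K e := (arrow_or0 (red_kept hv e)).
Local Notation Ks e := (ghost_or0 (red_kept hv e)).
Local Notation P e g := (arrow_or0 (red_path hv e g)).
Local Notation Ps e g := (ghost_or0 (red_path hv e g)).

Lemma vert_or0_val (u : vert L) : V (val u) = lvert k u.
Proof. by rewrite /vert_or0 valK. Qed.

Lemma vert_or0_v : V v = 0.
Proof. by rewrite /vert_or0 insubF ?eqxx. Qed.

Lemma vert_or0M w w' : V w ** V w' = if w == w' then V w else 0.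
Proof.
rewrite /vert_or0; case: insubP => [u _ <-|/negPn/eqP->] /=; last first.
  by rewrite nu0mul if_same.
case: insubP => [u' _ <-|/negPn/eqP->] /=; last first.
  by rewrite numul0; case: eqP => // uv; have := valP u; rewrite /= uv eqxx.
by rewrite lvertM -val_eqE.
Qed.

Lemma red_keptP e x : red_kept hv e = Some x ->
  val (src x) = src e /\ val (tgt x) = tgt e.
Proof. by rewrite /red_kept; case: insubP => //= y _ ye [<-] /=; rewrite ye. Qed.

Lemma red_pathP e g x : red_path hv e g = Some x ->
  val (src x) = src e /\ val (tgt x) = tgt g.
Proof. by rewrite /red_path; case: insubP => //= y _ ye [<-] /=; rewrite ye. Qed.

Lemma kept_src e : V (src e) ** K e = K e.
Proof.
case E: (red_kept hv e) => [x|] /=; last by rewrite numul0.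
by have [<- _] := red_keptP E; rewrite vert_or0_val larrow_src.
Qed.

Lemma kept_tgt e : K e ** V (tgt e) = K e.
Proof.
case E: (red_kept hv e) => [x|] /=; last by rewrite nu0mul.
by have [_ <-] := red_keptP E; rewrite vert_or0_val larrow_tgt.
Qed.

Lemma kept_ghost_src e : V (tgt e) ** Ks e = Ks e.
Proof.
case E: (red_kept hv e) => [x|] /=; last by rewrite numul0.
by have [_ <-] := red_keptP E; rewrite vert_or0_val lghost_src.
Qed.

Lemma kept_ghost_tgt e : Ks e ** V (src e) = Ks e.
Proof.
case E: (red_kept hv e) => [x|] /=; last by rewrite nu0mul.
by have [<- _] := red_keptP E; rewrite vert_or0_val lghost_tgt.
Qed.

Lemma path_src e g : V (src e) ** P e g = P e g.
Proof.
case E: (red_path hv e g) => [x|] /=; last by rewrite numul0.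
by have [<- _] := red_pathP E; rewrite vert_or0_val larrow_src.
Qed.

Lemma path_tgt e g : P e g ** V (tgt g) = P e g.
Proof.
case E: (red_path hv e g) => [x|] /=; last by rewrite nu0mul.
by have [_ <-] := red_pathP E; rewrite vert_or0_val larrow_tgt.
Qed.

Lemma path_ghost_src e g : V (tgt g) ** Ps e g = Ps e g.
Proof.
case E: (red_path hv e g) => [x|] /=; last by rewrite numul0.
by have [_ <-] := red_pathP E; rewrite vert_or0_val lghost_src.
Qed.

Lemma path_ghost_tgt e g : Ps e g ** V (src e) = Ps e g.
Proof.
case E: (red_path hv e g) => [x|] /=; last by rewrite nu0mul.
by have [<- _] := red_pathP E; rewrite vert_or0_val lghost_tgt.
Qed.

Lemma kept_src_v e : src e = v -> red_kept hv e = None.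
Proof. by move=> ev; rewrite red_keptF // ev eqxx. Qed.

Lemma path_src_v e g : src e = v -> red_path hv e g = None.
Proof. by move=> ev; rewrite red_pathF // (negbTE (loopless_tgt hv ev)). Qed.

(** CK1 for kept arrows and paths at once: [red_arrow] is injective where it is defined, and
    undefined pairs contribute 0. *)
Lemma ghost_arrow_or0 p q :
  ghost_or0 (red_arrow hv p) ** arrow_or0 (red_arrow hv q) =
  if p == q then oapp (fun x : arrow L => lvert k (tgt x)) 0 (red_arrow hv p) else 0.
Proof.
case: eqP => [<-|pq].
  by case: (red_arrow hv p) => [x|] /=; rewrite ?nu0mul // lghost_arrow eqxx.
case Ep: (red_arrow hv p) => [x|] /=; last by rewrite nu0mul.
case Eq: (red_arrow hv q) => [y|] /=; last by rewrite numul0.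
rewrite lghost_arrow; case: eqP => // xy; case: pq.
have := red_arrowK hv p; have := red_arrowK hv q.
by rewrite Ep Eq xy /= => <- <-.
Qed.

Lemma kept_CK1 e f : Ks e ** K f =
  if (e == f) && (src e != v) then V (tgt e) else 0.
Proof.
rewrite (ghost_arrow_or0 (e, None) (f, None)) xpair_eqE eqxx andbT.
case: (e == f) => //=; rewrite /red_arrow /=.
case E: (red_kept hv e) => [x|] /=.
  have [xs <-] := red_keptP E; rewrite vert_or0_val -xs.
  by rewrite (valP (src x)).
(* An arrow that is not kept although it starts away from [v] must end at [v], where [V v] is 0. *)
case: ifP => // se; case: (eqVneq (tgt e) v) => [->|te]; first by rewrite vert_or0_v.
have p : (src e != v) && (tgt e != v) by rewrite se.
by rewrite (red_keptT hv p) in E.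
Qed.

Lemma kept_path_CK1 e f g : Ks e ** P f g = 0.
Proof. by rewrite (ghost_arrow_or0 (e, None) (f, Some g)) xpair_eqE andbF. Qed.

Lemma path_kept_CK1 e f g : Ps f g ** K e = 0.
Proof. by rewrite (ghost_arrow_or0 (f, Some g) (e, None)) xpair_eqE andbF. Qed.

Lemma path_CK1 e f (g h : outs v) : Ps e (val g) ** P f (val h) =
  if (e == f) && (g == h) && (tgt e == v) then V (tgt (val g)) else 0.
Proof.
rewrite (ghost_arrow_or0 (e, Some (val g)) (f, Some (val h))) xpair_eqE.
rewrite (inj_eq (@Some_inj _)) (inj_eq val_inj); case: andP => //= _.
rewrite /red_arrow /=; case E: (red_path hv e _) => [x|] /=.
  have [xs <-] := red_pathP E; rewrite vert_or0_val.
  case: ifP => // te; by rewrite red_pathF // te in E.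
case: ifP => // te.
have p : (tgt e == v) && (src (val g) == v) by rewrite te (outs_src hG) eqxx.
by rewrite (red_pathT hv p) in E.
Qed.

(** Row and column [None] stand for the retained vertices, [Some g] for the
    summand [g ** A] of [v ** A], which is isomorphic to [tgt g ** A]. *)
Definition mat_gen (x : lpa_gen G) : nmat B (option (outs v)) :=
  match x with
  | GVert w => blk (V w) (fun=> 0) (fun=> 0)
      (fun g h => if (g == h) && (src (val g) == w) then V (tgt (val g)) else 0)
  | GArrow e => blk (K e) (fun g => P e (val g))
      (fun g => if val g == e then V (tgt e) else 0) (fun _ _ => 0)
  | GGhost e => blk (Ks e) (fun g => if val g == e then V (tgt e) else 0)
      (fun g => Ps e (val g)) (fun _ _ => 0)
  end.

Lemma sum_mull0 (F : outs v -> B) : \sum_z 0 ** F z = 0.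
Proof. by rewrite big1 // => z _; rewrite nu0mul. Qed.

Lemma sum_mulr0 (F : outs v -> B) : \sum_z F z ** 0 = 0.
Proof. by rewrite big1 // => z _; rewrite numul0. Qed.

Lemma sum_mul_diagl x (c : bool) (a : B) (F : outs v -> B) :
  \sum_z (if (x == z) && c then a else 0) ** F z = if c then a ** F x else 0.
Proof.
rewrite (bigD1 x) //= big1 => [|z zx]; last by rewrite eq_sym (negbTE zx) nu0mul.
by rewrite eqxx addr0; case: c; rewrite ?nu0mul.
Qed.

Lemma sum_mul_diagr y (c : pred (outs v)) (a F : outs v -> B) :
  \sum_z F z ** (if (z == y) && c z then a z else 0) =
  if c y then F y ** a y else 0.
Proof.
rewrite (bigD1 y) //= big1 => [|z zy]; last by rewrite (negbTE zy) numul0.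
by rewrite eqxx addr0; case: (c y); rewrite ?numul0.
Qed.

Let simp0 := (sum_mull0, sum_mulr0, sum_mul_diagl, sum_mul_diagr,
  numul0, nu0mul, big1_eq, addr0, add0r).

Lemma vert_or0_id w : V w ** V w = V w.
Proof. by rewrite vert_or0M eqxx. Qed.

Lemma path_tgt_v e g : tgt e != v -> red_path hv e g = None.
Proof. by move=> ev; rewrite red_pathF // (negbTE ev). Qed.

Lemma outs_val e : src e = v -> exists e0 : outs v, val e0 = e.
Proof.
move=> ev; have p : e \in outs v by rewrite (mem_outs hG) ev.
by exists [` p]%fset.
Qed.

Lemma outs_val_eq e (e0 z : outs v) :
  val e0 = e -> (val z == e) = (z == e0) && true.
Proof. by move=> <-; rewrite andbT (inj_eq val_inj). Qed.

(** If [e] starts at [v], only its indicator entries survive, and they meet those of [f] in the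
    corner. Otherwise these vanish, and CK1 in [L] gives the corner and the square block. *)
Lemma mat_gen_CK1 e f : mat_gen (GGhost e) ** mat_gen (GArrow f) =
  if e == f then mat_gen (GVert (tgt e)) else 0.
Proof.
have -> : (if e == f then mat_gen (GVert (tgt e)) else 0) =
  blk (if e == f then V (tgt e) else 0)
  (fun=> 0) (fun=> 0) (fun g h => if (e == f) && (g == h) && (tgt e == v)
     then V (tgt (val g)) else 0).
  case: (e == f) => /=; last by rewrite blk0.
  by apply: blk_eq => // x y; rewrite (outs_src hG) (eq_sym v).
rewrite /= blkM; case: (eqVneq (src e) v) => [ev|ev].
  have [e0 ee0] := outs_val ev; rewrite (kept_src_v ev).
  apply: blk_eq => [|y|x|x y] /=; rewrite ?(path_src_v _ ev) /= ?simp0 //.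
    under eq_bigr do rewrite (outs_val_eq _ ee0) (eq_sym _ e0).
    rewrite sum_mul_diagl ee0; case: eqP => [<-|_]; last by rewrite numul0.
    by rewrite vert_or0_id.
  by rewrite (negbTE (loopless_tgt hv ev)) andbF.
have eF (z : outs v) : (val z == e) = false.
  by apply/negbTE; apply: contraNneq ev => <-; rewrite (outs_src hG).
apply: blk_eq => [|y|x|x y]; rewrite ?kept_path_CK1 ?path_kept_CK1 ?simp0 //.
- rewrite kept_CK1 ev andbT big1 ?addr0 // => z _; by rewrite eF nu0mul.
- by rewrite path_CK1.
Qed.

(** The corner is CK2 in [L], rearranged by [sum_red_out], or 0 when [w] is [v]. In the square block
    each [e] out of [v] contributes exactly its own diagonal entry. *)
Lemma mat_gen_CK2 w : ~ sink w -> mat_gen (GVert w) =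
  \sum_(e <- outs w) mat_gen (GArrow e) ** mat_gen (GGhost e).
Proof.
move=> sw; under eq_bigr do rewrite /= blkM.
rewrite blk_sum; apply: blk_eq => [|y|x|x y].
- case: (eqVneq w v) => [->|wv].
    rewrite vert_or0_v big_seq big1 // => e; rewrite (mem_outs hG) => /eqP ev.
    rewrite (kept_src_v ev) /= nu0mul add0r big1 // => z _.
    by rewrite (path_src_v _ ev) /= nu0mul.
  pose u : red_vert v := Sub w wv.
  rewrite -[w]/(val (u : vert L)) vert_or0_val.
  rewrite (lvert_CK2 k (row_finite_reduce hG u) (@red_sink _ _ hv sv u sw)) (sum_red_out hG).
  apply: eq_bigr => e _; congr (_ + _).
    by case: (red_kept hv e) => [x|] /=; rewrite ?numul0.
  rewrite big_seq_fsetE; apply: eq_bigr => g _.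
  by case: (red_path hv e (val g)) => [x|] /=; rewrite ?numul0.
- rewrite big1 // => e _; rewrite !simp0; case: eqP => [<-|_]; last by rewrite numul0.
  by rewrite (kept_src_v (outs_src hG y)) /= nu0mul.
- rewrite big1 // => e _; rewrite !simp0; case: eqP => [<-|_]; last by rewrite nu0mul.
  by rewrite (kept_src_v (outs_src hG x)) /= numul0.
- under eq_bigr do rewrite !simp0.
  case: (eqVneq x y) => [<-|xy] /=; last first.
    rewrite big1 // => e _; case: eqP => [<-|_]; last by rewrite nu0mul.
    by rewrite (inj_eq val_inj) eq_sym (negbTE xy) numul0.
  rewrite -(mem_outs hG (val x) w); case: ifPn => xw; last first.
    rewrite big_seq big1 // => e ew; case: eqP => [xe|_]; last by rewrite nu0mul.
    by case/negP: xw; move: ew; rewrite -xe.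
  rewrite (big_fsetD1 (val x)) //= eqxx vert_or0_id big_seq big1 ?addr0 // => e.
  by rewrite !inE eq_sym => /andP[/negbTE -> _]; rewrite nu0mul.
Qed.

Lemma mat_gen_rel x y : @lpa_rel k G x y -> eval mat_gen x = eval mat_gen y.
Proof.
case=> {x y} [w w'|e|e|e|e|e f|w fw sw].
(* The case distinction is pushed into the blocks so that both sides can be compared blockwise. *)
- have -> : eval mat_gen (if w == w' then Gen (GVert w) else Zero) =
    blk (if w == w' then V w else 0) (fun=> 0) (fun=> 0)
      (fun g h => if (g == h) && ((w == w') && (src (val g) == w))
        then V (tgt (val g)) else 0).
    case: (w == w') => //=; rewrite -blk0.
    by apply: blk_eq => // x y; rewrite andbF.
  rewrite /= blkM; apply: blk_eq => [|y|x|x y]; rewrite ?simp0 ?vert_or0M //.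
  case: (eqVneq (src (val x)) w) => [<-|_]; last by rewrite !andbF.
  rewrite andbT; case: (x == y) => /=; last by rewrite numul0.
  by case: (_ == _); rewrite ?numul0 ?vert_or0_id.
- rewrite /= blkM; apply: blk_eq => [|y|x|x y]; rewrite ?simp0 ?kept_src ?path_src //.
  case: (eqVneq (val x) e) => [->|_]; last by rewrite numul0 if_same.
  by rewrite eqxx vert_or0_id.
- rewrite /= blkM; apply: blk_eq => [|y|x|x y]; rewrite ?simp0 ?kept_tgt //.
    rewrite (outs_src hG) path_tgt; case: eqP => // /eqP; rewrite eq_sym => te.
    by rewrite path_tgt_v.
  by case: ifP; rewrite ?vert_or0_id ?nu0mul.
- rewrite /= blkM; apply: blk_eq => [|y|x|x y]; rewrite ?simp0 ?kept_ghost_src //.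
    by case: ifP; rewrite ?vert_or0_id ?numul0.
  rewrite (outs_src hG) path_ghost_src; case: eqP => // /eqP; rewrite eq_sym => te.
  by rewrite path_tgt_v.
- rewrite /= blkM; apply: blk_eq => [|y|x|x y];
    rewrite ?simp0 ?kept_ghost_tgt ?path_ghost_tgt //.
  case: (eqVneq (val y) e) => [->|_]; last by rewrite nu0mul if_same.
  by rewrite eqxx vert_or0_id.
- by rewrite [LHS]/= mat_gen_CK1; case: ifP.
- by rewrite eval_sum; exact: mat_gen_CK2.
Qed.

Definition mat_hom := presented_lift mat_gen_rel.

(** Checked on generators. For a path [f g], the row of [f] meets the indicator column of [g], and
    their product is the new arrow in the corner. *)
Lemma mat_red_hom b : mat_hom (phi b) = delta None None b.
Proof.
have matV w : mat_hom (lvert k w) = mat_gen (GVert w) := presented_liftE _ _.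
have matE e : mat_hom (larrow k e) = mat_gen (GArrow e) := presented_liftE _ _.
have matS e : mat_hom (lghost k e) = mat_gen (GGhost e) := presented_liftE _ _.
elim/leavitt_ind: b.
- move=> u; rewrite red_hom_vert matV -blk_delta.
  apply: blk_eq => //= [|x y]; first by rewrite vert_or0_val.
  by have /= /negbTE uv := red_vertP u; rewrite (outs_src hG) (eq_sym v) uv andbF.
- case=> [e|fg].
    rewrite red_hom_arrow matE -blk_delta; apply: blk_eq => //= [|y|x].
    + by rewrite red_kept_val.
    + by rewrite (path_tgt_v _ (kept_tgtP e)).
    case: eqP => // xe; have := kept_srcP e.
    by rewrite -[val e]xe outs_src // eqxx.
  have [tf sg] := path2P fg; have [g0 gg0] := outs_val sg.
  rewrite red_hom_arrow nuhomM !matE -blk_delta blkM (kept_src_v sg).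
  apply: blk_eq => [|y|x|x y]; rewrite ?(path_src_v _ sg) /= ?simp0 //.
  under eq_bigr do rewrite (outs_val_eq _ gg0).
  rewrite sum_mul_diagr gg0 path_tgt.
  by rewrite red_path_val.
- case=> [e|fg].
    rewrite red_hom_ghost matS -blk_delta; apply: blk_eq => //= [|y|x].
    + by rewrite red_kept_val.
    + case: eqP => // xe; have := kept_srcP e.
      by rewrite -[val e]xe outs_src // eqxx.
    by rewrite (path_tgt_v _ (kept_tgtP e)).
  have [tf sg] := path2P fg; have [g0 gg0] := outs_val sg.
  rewrite red_hom_ghost nuhomM !matS -blk_delta blkM (kept_src_v sg).
  apply: blk_eq => [|y|x|x y]; rewrite ?(path_src_v _ sg) /= ?simp0 //.
  under eq_bigr do rewrite (outs_val_eq _ gg0) (eq_sym _ g0).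
  rewrite sum_mul_diagl gg0 path_ghost_src.
  by rewrite red_path_val.
- by rewrite !nuhom0 delta0.
- by move=> a b IHa IHb; rewrite !nuhomD IHa IHb deltaD.
- by move=> c a IH; rewrite !nuhomZ IH deltaZ.
- by move=> a b IHa IHb; rewrite !nuhomM IHa IHb deltaM eqxx.
Qed.

End ReductionMatrices.

(** * Composition of reductions *)

Section CompleteReduction.
Variable k : comPzRingType.

(** What is carried through the induction on reductions: enough for the equivalence and the
    embedding, and stable under composition. *)
Definition corner_embedding (G L : digraph) (iota : vert L -> vert G)
    (phi : nuhom (leavitt k L) (leavitt k G)) :=
  [/\ injective phi, full_vertices k iota, corner_in_range iota phi
    & modules_extend iota phi].

Lemma corner_embedding_id (G : digraph) :
  corner_embedding id (nuhom_id (leavitt k G)).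
Proof.
split=> // [w|u a u'|N].
- by exists [:: (lvert k w, w, lvert k w)]; rewrite big_seq1 !lvert_id.
- by exists (lvert k u ** a ** lvert k u').
- by exists N, id; split=> // m u; exists (act m (lvert k u)).
Qed.

Lemma corner_embedding_step (G : digraph) (hG : row_finite G) (v : vert G)
    (hv : loopless v) (sv : ~ sink v) :
  corner_embedding (fun u : vert (reduce_at hv) => val u) (red_hom k hG hv sv).
Proof.
split.
- exact: matrix_hom_inj (mat_red_hom hG sv).
- exact: red_full_vertices.
- exact: red_corner_in_range.
- exact: matrix_modules_extend (red_hom_vert k hG sv) (mat_red_hom hG sv).
Qed.

(** Fullness follows by substituting one expansion into the other, corners by cutting twice with the
    same idempotents, and modules are extended first along [psi], then along [phi]. *)
Lemma corner_embedding_comp (G L H : digraph) (iota : vert L -> vert G)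
    (phi : nuhom (leavitt k L) (leavitt k G)) (kappa : vert H -> vert L)
    (psi : nuhom (leavitt k H) (leavitt k L)) :
  (forall u, phi (lvert k u) = lvert k (iota u)) ->
  corner_embedding iota phi -> corner_embedding kappa psi ->
  corner_embedding (fun u => iota (kappa u)) (nuhom_comp phi psi).
Proof.
move=> phiV [phi_inj iota_full phi_corner phi_ext].
move=> [psi_inj kappa_full psi_corner psi_ext]; split.
- by move=> a b /phi_inj/psi_inj.
- move=> w; have [s ->] := iota_full w.
  have factor (p : leavitt k G * vert L * leavitt k G) :
      exists t : seq (leavitt k G * vert H * leavitt k G),
      p.1.1 ** lvert k (iota p.1.2) ** p.2 =
      \sum_(q <- t) q.1.1 ** lvert k (iota (kappa q.1.2)) ** q.2.
    have [t tE] := kappa_full p.1.2.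
    exists [seq (p.1.1 ** phi q.1.1 ** lvert k (iota (kappa q.1.2)), q.1.2,
                 phi q.2 ** p.2) | q <- t].
    rewrite -phiV tE raddf_sum numul_sumr numul_suml big_map.
    apply: eq_bigr => q _ /=; rewrite !nuhomM phiV -!numulA; congr (_ ** _).
    by congr (_ ** _); rewrite [in RHS]numulA lvert_id.
  have /choice[f fE] := factor.
  exists (flatten (map f s)); rewrite big_flatten big_map.
  by apply: eq_bigr => p _.
- move=> u a u'; have [b bE] := phi_corner (kappa u) a (kappa u').
  have [c cE] := psi_corner u b u'; exists c.
  rewrite /= cE !nuhomM bE !phiV !numulA lvert_id -!numulA.
  by rewrite lvert_id.
- move=> N; have [M' [f [fD f_inj fA fim]]] := psi_ext N.
  have [M [g [gD g_inj gA gim]]] := phi_ext M'; exists M, (fun n => g (f n)).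
  split=> [m n|m n /g_inj/f_inj|n b|m u] //; first by rewrite fD gD.
    by rewrite fA gA.
  (* The vertex is idempotent, so it can be applied twice: once to reach the image of [g], and once
     inside [M'] to reach that of [f]. *)
  have [n nE] := gim m (kappa u); have [n' n'E] := fim n u; exists n'.
  by rewrite -n'E gA phiV -nE -actM lvert_id.
Qed.

Lemma reduction_hom_id (G : digraph) :
  reduction_hom id (fun e => [:: e]) (nuhom_id (leavitt k G)).
Proof.
split=> //= e; first by rewrite /lpath /= larrow_src.
by rewrite /lpath_star /= lghost_tgt.
Qed.

Lemma reduction_hom_step (G L : digraph) (iota : vert L -> vert G)
    (lab : arrow L -> seq (arrow G)) (phi : nuhom (leavitt k L) (leavitt k G))
    (hL : row_finite L) (v : vert L) (hv : loopless v) (sv : ~ sink v) :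
  reduction_hom iota lab phi ->
  reduction_hom (fun u : vert (reduce_at hv) => iota (val u))
    (fun x : arrow (reduce_at hv) => match x with
       | inl e => lab (val e)
       | inr fg => lab (val fg).1 ++ lab (val fg).2
       end)
    (nuhom_comp phi (red_hom k hL hv sv)).
Proof.
move=> [phiV phiE phiS]; split=> [u|[e|fg]|[e|fg]].
- by rewrite nuhom_compE red_hom_vert phiV.
- by rewrite nuhom_compE red_hom_arrow /= phiE.
- have [tf sg] := path2P fg; have sgtf := etrans sg (esym tf).
  rewrite nuhom_compE red_hom_arrow /= nuhomM !phiE lpath_cat.
    by rewrite /lpath foldl_cat.
  by rewrite -phiE sgtf -phiV -nuhomM larrow_tgt.
- by rewrite nuhom_compE red_hom_ghost /= phiS.
- have [tf sg] := path2P fg; have sgtf := etrans sg (esym tf).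
  rewrite nuhom_compE red_hom_ghost /= nuhomM !phiS lpath_star_cat.
    by rewrite /lpath_star foldl_cat.
  by rewrite -phiS sgtf -phiV -nuhomM lghost_src.
Qed.

(** Row-finiteness of [L] is part of the induction because the next step needs it for its
    homomorphism. *)
Lemma reduction_corner_embedding (G L : digraph) (iota : vert L -> vert G)
    (lab : arrow L -> seq (arrow G)) :
  row_finite G -> reduction iota lab ->
  row_finite L /\ exists phi : nuhom (leavitt k L) (leavitt k G),
    reduction_hom iota lab phi /\ corner_embedding iota phi.
Proof.
move=> hG; elim=> {L iota lab} [|L iota lab v hv _ [hL [phi [phiP phi_corner]]] sv].
  split=> //; exists (nuhom_id _); split; first exact: reduction_hom_id.
  exact: corner_embedding_id.
split; first exact: row_finite_reduce.
exists (nuhom_comp phi (red_hom k hL hv sv)); split.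
  exact: reduction_hom_step.
apply: corner_embedding_comp phi_corner (corner_embedding_step hL hv sv).
exact: reduction_hom_vert phiP.
Qed.

End CompleteReduction.

Theorem theorem20 (k : comPzRingType) (G : digraph) (hG : row_finite G)
    (L : digraph) (iota : vert L -> vert G) (lab : arrow L -> seq (arrow G))
    (hL : reduction iota lab) :
  [/\ morita_equivalent (leavitt k G) (leavitt k L),
      isomorphic_to_subalgebra (leavitt k L) (leavitt k G)
    & exists (phi : nuhom (leavitt k L) (leavitt k G))
             (hphi : reduction_hom iota lab phi),
        is_equivalence (restriction (reduction_hom_vert hphi))].
Proof.
have [_ [phi [hphi [phi_inj iota_full corner ext]]]] :=
  reduction_corner_embedding k hG hL.
have equiv : is_equivalence (restriction (reduction_hom_vert hphi)).
  exact: restriction_equivalence.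
split; [by exists (restriction (reduction_hom_vert hphi)) | | by exists phi, hphi].
(* The subalgebra is the image of [phi], which is injective. *)
exists (range phi); last first.
  exists phi; split=> [a _|a b _ _|b [a _ <-]]; [by exists a | exact: phi_inj |].
  by exists a.
split=> [|_ _ [a _ <-] [b _ <-]|c _ [a _ <-]|_ _ [a _ <-] [b _ <-]].
- by exists 0; rewrite ?nuhom0.
- by exists (a + b); rewrite ?nuhomD.
- by exists (c *: a); rewrite ?nuhomZ.
- by exists (a ** b); rewrite ?nuhomM.
Qed.
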